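(* Let $b\ge2$, $s,m\in\mathbb{N}$, integer $\alpha\ge2$, weights $\gamma_1,\dots,\gamma_s\ge0$. Let $\mathcal{P}\subset G^s$ be a digital net with generating matrices in $\mathbb{Z}_b^{\mathbb{N}\times m}$, $\mathcal{P}^\perp$ its dual net and $\mathcal{P}_{\Phi_b}$ its folded digital net. Then the worst-case error of the QMC rule using $\pi(\mathcal{P}_{\Phi_b})$ in the weighted unanchored Sobolev space $\mathcal{H}_\alpha$ with reproducing kernel $\mathcal{K}_\alpha$ satisfies $$e(\pi(\mathcal{P}_{\Phi_b}),\mathcal{K}_\alpha)\le\sum_{\emptyset\ne u\subseteq\{1,\dots,s\}}\gamma_u^{1/2}D_{\alpha,b}^{|u|/2}\sum_{\substack{\boldsymbol k_u\in\mathcal{E}^{|u|}\\(\boldsymbol k_u,\boldsymbol 0)\in\mathcal{P}^\perp}}b^{-\mu_\alpha(\lfloor\boldsymbol k_u/b\rfloor)},$$ where $\mu_\alpha(\lfloor\boldsymbol k_u/b\rfloor)=\sum_{j\in u}\mu_\alpha(\lfloor k_j/b\rfloor)$.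
   Context: $G=\prod_{i=1}^\infty\mathbb{Z}_b$ (coordinatewise addition mod $b$). A digital net in $G^s$ with generating matrices $C_1,\dots,C_s\in\mathbb{Z}_b^{\mathbb{N}\times m}$ is $\{\boldsymbol z_h:0\le h<b^m\}$, $\boldsymbol z_h=(C_1\vec h,\dots,C_s\vec h)$ with $\vec h$ the $b$-adic digit vector of $h$; dual net $\mathcal{P}^\perp=\{\boldsymbol k\in\mathbb{N}_0^s:\sum_jC_j^\top\vec k_j=\boldsymbol0\in\mathbb{Z}_b^m\}$ with $\vec k_j$ the digit vector of $k_j$. $\Phi_b((\zeta_1,\zeta_2,\dots)^\top)=(\zeta_{i+1}-\zeta_1 \bmod b)_{i\ge1}$; folded net $\mathcal{P}_{\Phi_b}=\{\Phi_b(\boldsymbol z):\boldsymbol z\in\mathcal{P}\}$ (coordinatewise). $\pi((\zeta_i)_i)=\sum_i\zeta_ib^{-i}$ coordinatewise; the QMC rule using $\pi(\mathcal{Q})$ is $f\mapsto|\mathcal{Q}|^{-1}\sum_{\boldsymbol z\in\mathcal{Q}}f(\pi(\boldsymbol z))$ and $e(\pi(\mathcal{Q}),\mathcal{K})$ is the supremum of the absolute integration error over the unit ball of the RKHS with kernel $\mathcal{K}$. $\mathcal{H}_\alpha$ is the RKHS on $[0,1]^s$ with kernel $\mathcal{K}_\alpha(\boldsymbol x,\boldsymbol y)=\prod_{j=1}^s(1+\gamma_j\mathcal{K}_{\alpha,(1)}(x_j,y_j))$, where $\mathcal{K}_{\alpha,(1)}(x,y)=\sum_{\tau=1}^\alpha\frac{B_\tau(x)B_\tau(y)}{(\tau!)^2}+(-1)^{\alpha+1}\frac{B_{2\alpha}(|x-y|)}{(2\alpha)!}$,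 $B_\tau$ the Bernoulli polynomial of degree $\tau$. $\gamma_u=\prod_{j\in u}\gamma_j$. For $k\in\mathbb{N}$ written $k=\kappa_1b^{a_1-1}+\dots+\kappa_vb^{a_v-1}$ with $0<\kappa_i<b$, $a_1>\dots>a_v>0$, $\mu_\alpha(k)=a_1+\dots+a_{\min(v,\alpha)}$. $D_{\alpha,b}>0$ is a constant depending only on $\alpha,b$ such that the one-dimensional Walsh coefficients satisfy $|\hat{\mathcal{K}}_{\alpha,(1)}(k,l)|\le D_{\alpha,b}b^{-\mu_\alpha(k)-\mu_\alpha(l)}$ for all $k,l\in\mathbb{N}$, where $\hat{\mathcal{K}}_{\alpha,(1)}(k,l)=\int_0^1\!\int_0^1\mathcal{K}_{\alpha,(1)}(x,y)\overline{\mathrm{wal}_k(x)}\mathrm{wal}_l(y)\,dx\,dy$ and $\mathrm{wal}_k$ is the $k$-th $b$-adic Walsh function (such a constant exists). $\delta(k)$ = $b$-adic digit sum, $\mathcal{E}=\{k\in\mathbb{N}:\delta(k)\equiv0\pmod b\}$. $(\boldsymbol k_u,\boldsymbol0)$ is the vector in $\mathbb{N}_0^s$ with entries $k_j$ for $j\in u$ and $0$ otherwise. *)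

(* Defs.v *)
From HB Require Import structures.
From mathcomp Require Import all_boot all_order all_algebra.
From mathcomp Require Import all_classical all_reals all_analysis.
Set Implicit Arguments. Unset Strict Implicit. Unset Printing Implicit Defensive.
Import Order.TTheory GRing.Theory Num.Theory.
Import numFieldNormedType.Exports.
Local Open Scope classical_set_scope.
Local Open Scope ring_scope.

Definition ndigit (b a k : nat) : nat := (k %/ b ^ a) %% b.

(* delta(k): b-adic digit sum (digits at positions >= k vanish since k < b^k). *)
Definition digsum (b k : nat) : nat := (\sum_(a < k) ndigit b a k)%N.

Definition Eset (b k : nat) : bool := (0 < k)%N && (digsum b k %% b == 0)%N.

(* mu_alpha(k) = a_1 + ... + a_{min(v,alpha)}, where a_1 > ... > a_v are the
   (1-based) positions of the nonzero b-adic digits of k; mu_alpha(0) = 0. *)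
Definition mu_alpha (b alpha k : nat) : nat :=
  sumn (take alpha (rev [seq a.+1 | a <- iota 0 k & ndigit b a k != 0%N])).

(* bern_nums n = [:: B_0; ...; B_n] with B_0 = 1 and
   B_n = -1/(n+1) * sum_{k<n} C(n+1,k) B_k  (so B_1 = -1/2). *)
Fixpoint bern_nums (R : fieldType) (n : nat) : seq R :=
  match n with
  | 0 => [:: 1]
  | n'.+1 => let s := bern_nums R n' in
      rcons s (- (n'.+2)%:R^-1 * \sum_(k < n'.+1) 'C(n'.+2, k)%:R * s`_k)
  end.
Definition bernoulli_number (R : fieldType) (n : nat) : R := (bern_nums R n)`_n.
Definition bernoulli_poly {R : fieldType} (n : nat) (x : R) : R :=
  \sum_(k < n.+1) 'C(n, k)%:R * bernoulli_number R k * x ^+ (n - k).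

Definition K1 {R : realType} (alpha : nat) (x y : R) : R :=
  \sum_(1 <= t < alpha.+1) bernoulli_poly t x * bernoulli_poly t y / ((t`!)%:R ^+ 2)
  + (-1) ^+ alpha.+1 * bernoulli_poly (2 * alpha) `|x - y| / ((2 * alpha)`!)%:R.

Definition Kalpha {R : realType} (s alpha : nat) (gamma : 'I_s -> R)
  (x y : 'I_s -> R) : R :=
  \prod_(j < s) (1 + gamma j * K1 alpha (x j) (y j)).

Definition I01 {R : realType} : set R := [set x | 0 <= x <= 1].

Fixpoint iter_int {R : realType} (n : nat) (f : (nat -> R) -> R) : R :=
  match n with
  | 0 => f (fun _ => 0)
  | n'.+1 => \int[@lebesgue_measure R]_(t in I01)
               iter_int n' (fun x => f (fun i => if i == n' then t else x i))
  end.

Definition cube_int {R : realType} (s : nat) (f : ('I_s -> R) -> R) : R :=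
  iter_int s (fun x => f (fun j => x (nat_of_ord j))).

(* xi_i(x) = i-th b-adic digit of x in [0,1) (1-based, finite expansion). *)
Definition xdigit {R : realType} (b i : nat) (x : R) : nat :=
  `|(Num.floor (x * (b%:R) ^+ i) %% (b%:Z))%Z|%N.

(* wal_k(x) = omega_b^(walsh_phase b k x), omega_b = exp(2 pi i / b) *)
Definition walsh_phase {R : realType} (b k : nat) (x : R) : nat :=
  (\sum_(a < k) ndigit b a k * xdigit b a.+1 x)%N.

(* conj(wal_k(x)) * wal_l(y) = exp(2 pi i (phase_l(y) - phase_k(x)) / b);
   real and imaginary parts of hat K(k,l) *)
Definition walsh_arg {R : realType} (b k l : nat) (x y : R) : R :=
  2 * pi * ((walsh_phase b l y)%:R - (walsh_phase b k x)%:R) / b%:R.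

Definition walsh_coef_re {R : realType} (b alpha k l : nat) : R :=
  \int[@lebesgue_measure R]_(y in I01) \int[@lebesgue_measure R]_(x in I01)
     (K1 alpha x y * cos (walsh_arg b k l x y)).

Definition walsh_coef_im {R : realType} (b alpha k l : nat) : R :=
  \int[@lebesgue_measure R]_(y in I01) \int[@lebesgue_measure R]_(x in I01)
     (K1 alpha x y * sin (walsh_arg b k l x y)).

Definition walsh_coef_abs {R : realType} (b alpha k l : nat) : R :=
  Num.sqrt (walsh_coef_re (R:=R) b alpha k l ^+ 2 + walsh_coef_im (R:=R) b alpha k l ^+ 2).

(* G = prod_{i>=1} Z_b, coordinates indexed 0-based: z i = zeta_{i+1}. *)
Definition net_point (b s m : nat) (C : 'I_s -> nat -> 'I_m -> 'Z_b) (h : nat)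
  : 'I_s -> nat -> 'Z_b :=
  fun j i => \sum_(r < m) C j i r * (ndigit b r h)%:R.

Definition fold_b (b : nat) (z : nat -> 'Z_b) : nat -> 'Z_b :=
  fun i => z i.+1 - z 0%N.

Definition pi_b {R : realType} (b : nat) (z : nat -> 'Z_b) : R :=
  limn (fun n : nat => (\sum_(i < n) ((nat_of_ord (z i))%:R / (b%:R) ^+ i.+1) : R)).

Definition folded_point {R : realType} (b s m : nat)
  (C : 'I_s -> nat -> 'I_m -> 'Z_b) (h : nat) : 'I_s -> R :=
  fun j => @pi_b R b (@fold_b b (net_point C h j)).

Definition in_dual (b s m : nat) (C : 'I_s -> nat -> 'I_m -> 'Z_b)
  (k : 'I_s -> nat) : Prop :=
  forall r : 'I_m, \sum_(j < s) \sum_(i < k j) C j i r * (ndigit b i (k j))%:R = 0.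

Definition cube {R : realType} (s : nat) : set ('I_s -> R) :=
  [set x | forall j, 0 <= x j <= 1].

Definition kcomb_eval {R : realType} (s : nat) (K : ('I_s -> R) -> ('I_s -> R) -> R)
  (g : seq (R * ('I_s -> R))) (x : 'I_s -> R) : R :=
  \sum_(p <- g) p.1 * K x p.2.

Definition kcomb_norm2 {R : realType} (s : nat) (K : ('I_s -> R) -> ('I_s -> R) -> R)
  (g : seq (R * ('I_s -> R))) : R :=
  \sum_(p <- g) \sum_(q <- g) p.1 * q.1 * K p.2 q.2.

Definition kcomb_sub {R : realType} (s : nat) (g h : seq (R * ('I_s -> R))) :=
  g ++ [seq (- p.1, p.2) | p <- h].

(* f is in the unit ball of H(K): f is the pointwise limit on [0,1]^s of a
   Cauchy sequence (in the K-norm) of finite combinations of K(., y), y in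
   [0,1]^s, whose squared norms have limit <= 1. *)
Definition rkhs_unit_ball {R : realType} (s : nat)
  (K : ('I_s -> R) -> ('I_s -> R) -> R) : set (('I_s -> R) -> R) :=
  [set f | exists g : nat -> seq (R * ('I_s -> R)),
     [/\ (forall n i, (i < size (g n))%N -> @cube R s (nth (0, fun=> 0) (g n) i).2),
         (forall e : R, 0 < e -> exists N, forall n n', (N <= n)%N -> (N <= n')%N ->
              kcomb_norm2 K (kcomb_sub (g n) (g n')) <= e),
         (forall x, @cube R s x -> (fun n => kcomb_eval K (g n) x) @ \oo --> f x) &
         (forall e : R, 0 < e -> exists N, forall n, (N <= n)%N ->
              kcomb_norm2 K (g n) <= 1 + e)]].

Definition qmc_folded {R : realType} (b s m : nat) (C : 'I_s -> nat -> 'I_m -> 'Z_b)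
  (f : ('I_s -> R) -> R) : R :=
  (b ^ m)%:R^-1 * \sum_(h < b ^ m) f (folded_point C h).

Definition wce_folded {R : realType} (b s m alpha : nat) (gamma : 'I_s -> R)
  (C : 'I_s -> nat -> 'I_m -> 'Z_b) : \bar R :=
  ereal_sup [set (`| cube_int f - qmc_folded C f |)%:E
            | f in rkhs_unit_ball (Kalpha alpha gamma)].

Definition dual_Eu (b s m : nat) (C : 'I_s -> nat -> 'I_m -> 'Z_b) (u : {set 'I_s})
  : set {ffun 'I_s -> nat} :=
  [set k | in_dual C k /\
     (forall j, (j \in u -> Eset b (k j)) /\ (j \notin u -> k j = 0%N))].

Definition bound_rhs {R : realType} (b s m alpha : nat) (gamma : 'I_s -> R) (D : R)
  (C : 'I_s -> nat -> 'I_m -> 'Z_b) : \bar R :=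
  (\sum_(u : {set 'I_s} | u != finset.set0)
     ((Num.sqrt (\prod_(j in u) gamma j) * Num.sqrt D ^+ #|u|)%:E *
      \esum_(k in dual_Eu C u)
        ((b%:R : R) ^- (\sum_(j in u) mu_alpha b alpha (k j %/ b))%N)%:E))%E.

(* Main.v *)
Require Import Defs.
From mathcomp Require Import all_boot all_order all_algebra.
From mathcomp Require Import all_classical all_reals all_analysis.
From mathcomp Require Import complex.
From mathcomp Require Import ring lra zify.
Set Implicit Arguments. Unset Strict Implicit. Unset Printing Implicit Defensive.
Import Order.TTheory GRing.Theory Num.Theory.
Import numFieldNormedType.Exports.
Local Open Scope classical_set_scope.
Local Open Scope ring_scope.

(** A function f of the unit ball satisfies (sum_i c_i f(x_i))^2 <= sum_ij c_i c_j K(x_i, x_j)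
for all finite families in the cube, because K is positive semidefinite: the Bernoulli
part of K1 is the limit of averages of rank-one kernels, since
(-1)^(alpha+1) B_(2alpha)(|x-y|) / (2alpha)! is the convolution over the circle of
B_alpha / alpha! with itself, and Schur products preserve this property.  In particular f is
uniformly continuous, its integral is the limit of averages over uniform grids, and since
K1(., y) has mean zero the squared error is at most Q Q K - 1, where Q is the folded
average.

Expanding the product kernel over subsets u, it remains to bound Q Q prod_(j in u) K1.
Truncating the double Walsh series of K1 at level M gives the average of K1 over a pair of
b-adic cells, hence converges uniformly to K1 by continuity, also at points all of whose
digits are eventually b-1.  In the truncated series Q annihilates every Walsh function
except those whose index k is orthogonal to the folded net, that is, those for which the
unique k' with floor(k'/b) = k and digit sum divisible by b lies in the dual net; the bound
on the Walsh coefficients then gives a perfect square. *)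

(** Integrals are handled by comparison with averages over uniform grids, with explicit error
    bounds. On the Walsh side this leads to Fourier inversion on the finitely many pairs of b-adic
    cells of level M, followed by M going to infinity in an inequality between real numbers. The
    obstacle is that the folded net lives in G, where Walsh functions are characters, whereas K1
    takes real arguments; [pi_b] maps a cell of G only into the closed real cell. Partial Walsh sums
    are therefore evaluated on digit sequences. The condition on digit sums comes from folding being
    linear: with digits counted from 0, k paired with a folded point is the sum of k_a (z_(a+1) -
    z_0), which is the pairing of z with the index whose higher digits are those of k and whose
    lowest digit is minus the digit sum of k, modulo b. The square roots come from splitting D
    b^(-mu(k)-mu(l)) evenly between the two copies of Q: each subset contributes at most gamma_u
    D^|u| S_u^2 to the squared error, where S_u is its sum over the dual net, and a sum of squares
    of nonnegative numbers is at most the square of their sum. *)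

(** * Bernoulli polynomials and their symmetries *)

Section BernoulliPolynomials.
Variable R : realType.
Implicit Types (n k : nat) (x y : R).

Lemma size_bern_nums n : size (bern_nums R n) = n.+1.
Proof. by elim: n => //= n IH; rewrite size_rcons IH. Qed.

Lemma nth_bern_nums n k : (k <= n)%N -> (bern_nums R n)`_k = bernoulli_number R k.
Proof.
elim: n => [|n IH]; first by rewrite leqn0 => /eqP->.
rewrite leq_eqVlt => /predU1P[->//|kn].
by rewrite /= nth_rcons size_bern_nums kn IH.
Qed.

Lemma bernoulli_number_recur n :
  \sum_(k < n.+2) 'C(n.+2, k)%:R * bernoulli_number R k = 0.
Proof.
rewrite big_ord_recr /= {2}/bernoulli_number /= nth_rcons size_bern_nums ltnn eqxx.
under [in X in _ + X]eq_bigr => k _ do rewrite nth_bern_nums -1?ltnS //.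
by rewrite binSn mulNr mulrN mulrA divff ?pnatr_eq0// mul1r subrr.
Qed.

(* [bernp n] is B_n(X) / n!, so that differentiation lowers the index by one. *)
Definition bernp n : {poly R} :=
  \sum_(k < n.+1) (bernoulli_number R k / (k`! * (n - k)`!)%:R) *: 'X^(n - k).

Lemma horner_bernp n x : (bernp n).[x] = bernoulli_poly n x / (n`!)%:R.
Proof.
rewrite /bernp /bernoulli_poly horner_sum mulr_suml; apply: eq_bigr => -[k kn] _ /=.
rewrite hornerZ hornerXn -(@bin_fact n k) 1?mulnA // !natrM.
have : (0 < 'C(n, k))%N by rewrite bin_gt0.
rewrite lt0n => h.
by field; rewrite !pnatr_eq0 h -!lt0n !fact_gt0.
Qed.

Lemma bernp0 : bernp 0 = 1.
Proof. by rewrite /bernp big_ord1 /= invr1 mulr1 scale1r. Qed.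

Lemma deriv_bernp n : (bernp n.+1)^`() = bernp n.
Proof.
rewrite /bernp big_ord_recr /= subnn alg_polyC derivD derivC addr0.
rewrite (big_morph _ (@derivD _) (@deriv0 _)).
apply: eq_bigr => -[k kn] _ /=; rewrite derivZ derivXn subSn // factS /=.
rewrite -['X^_ *+ _]scaler_nat scalerA !natrM; congr (_ *: _).
have : (n - k).+1%:R != 0 :> R by rewrite pnatr_eq0.
set a : R := _.+1%:R => a0; clearbody a.
by field; rewrite a0 !pnatr_eq0 -!lt0n !fact_gt0.
Qed.

(** The recursion defining the Bernoulli numbers says exactly that all terms of the value at 1
    cancel except the constant term, which is the value at 0. *)
Lemma bernp_01 n : (bernp n.+2).[1] = (bernp n.+2).[0].
Proof.
rewrite !horner_bernp; congr (_ / _); rewrite /bernoulli_poly.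
rewrite 2!(big_ord_recr n.+2) /= subnn !expr0; congr (_ + _).
under eq_bigr do rewrite expr1n mulr1.
rewrite bernoulli_number_recur big1// => -[k kn] _ /=.
by rewrite expr0n subn_eq0 leqNgt kn mulr0.
Qed.

Lemma bernp1_01 : (bernp 1).[1] = (bernp 1).[0] + 1.
Proof.
rewrite !horner_bernp /bernoulli_poly !big_ord_recr !big_ord0 /= /bernoulli_number /=.
rewrite subnn subn0 !expr0 !expr1 bin0 binn (_ : 1`! = 1)%N //; by field.
Qed.

Lemma const_of_deriv0 (p : {poly R}) : p^`() = 0 -> p = (p.[0])%:P.
Proof.
move=> dp; apply/polyP => -[|i]; rewrite coefC horner_coef0 //=.
have /eqP := coef_deriv p i; rewrite dp coef0 eq_sym.
by rewrite mulrn_eq0 => /eqP.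
Qed.

(* Both sides have the same derivative; the constant they could differ by is
   killed by the equality of the boundary values one degree higher. *)
Lemma bernp_reflect n x : (bernp n).[1 - x] = (-1) ^+ n * (bernp n).[x].
Proof.
pose q k : {poly R} := (-1) ^+ k *: (bernp k \Po (1 - 'X)).
have dq k : (q k.+1)^`() = q k.
  rewrite /q derivZ deriv_comp deriv_bernp derivB derivX derivC sub0r mulrN1.
  by rewrite exprS mulN1r scaleNr scalerN opprK.
have q01 k : (q k.+2).[1] = (q k.+2).[0].
  by rewrite /q !hornerZ !horner_comp !hornerE /= subrr subr0 bernp_01.
suff H : bernp n = q n.
  rewrite {2}H /q hornerZ horner_comp (_ : (1 - 'X).[x] = 1 - x); last by rewrite !hornerE.
  rewrite mulrA -exprD addnn.
  by rewrite -mul2n exprM sqrrN expr1n expr1n mul1r.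
elim: n => [|n IH]; first by rewrite /q bernp0 expr0 scale1r comp_polyC.
pose d := bernp n.+1 - q n.+1.
have dE : d = (d.[0])%:P by apply: const_of_deriv0; rewrite derivB deriv_bernp dq IH subrr.
pose D := bernp n.+2 - q n.+2 - d.[0] *: 'X.
have DE : D = (D.[0])%:P.
  apply: const_of_deriv0; rewrite derivB derivB deriv_bernp dq derivZ derivX -/d.
  by rewrite {1}dE alg_polyC subrr.
suff d0 : d.[0] = 0 by apply/eqP; rewrite -subr_eq0 -/d dE d0.
have := congr1 (horner^~ 1) DE; rewrite hornerC /D !hornerD !hornerN bernp_01 q01.
by rewrite ![(_ *: 'X).[_]]hornerZ !hornerX => h; lra.
Qed.

(** For odd index, reflection at 0 makes the values at 0 and 1 opposite, while they are equal for
    every index from 2 on. *)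
Lemma bernp_odd0 n : (0 < n)%N -> (bernp (2 * n).+1).[0] = 0.
Proof.
case: n => // n _; have := bernp_reflect (2 * n.+1).+1 0.
rewrite subr0 exprS exprM sqrrN expr1n expr1n mulr1 mulN1r.
by rewrite mulnS bernp_01 => h; lra.
Qed.

End BernoulliPolynomials.

(** * Bounds for polynomials on [-1, 1] *)

Section PolynomialEstimates.
Variable R : realType.
Implicit Types (p : {poly R}) (x y : R).

(** The estimates of this part cover [-1, 1] and not only [0, 1], so that they apply to differences
    of two points of [0, 1]. *)
Lemma poly_bounded p : exists2 C : R, 0 <= C & forall x, `|x| <= 1 -> `|p.[x]| <= C.
Proof.
elim/poly_ind: p => [|p c [C C0 H]]; first by exists 0 => // x _; rewrite horner0 normr0.
exists (C + `|c|); first by rewrite addr_ge0.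
move=> x x1; rewrite hornerMXaddC (le_trans (ler_normD _ _)) // lerD2r normrM.
by rewrite -[C]mulr1 ler_pM // H.
Qed.

Lemma poly_taylor1 p : exists2 C : R, 0 <= C & forall x y, `|x| <= 1 -> `|y| <= 1 ->
  `|p.[y] - p.[x] - p^`().[x] * (y - x)| <= C * (y - x) ^+ 2.
Proof.
elim/poly_ind: p => [|p c [C C0 H]].
  by exists 0 => // x y _ _; rewrite deriv0 !horner0 !mul0r !subr0 normr0.
have [B B0 HB] := poly_bounded p^`().
exists (C + B); first by rewrite addr_ge0.
move=> x y x1 y1; rewrite derivMXaddC hornerD hornerMX !hornerMXaddC.
have -> : p.[y] * y + c - (p.[x] * x + c) - (p.[x] + p^`().[x] * x) * (y - x) =
  y * (p.[y] - p.[x] - p^`().[x] * (y - x)) + p^`().[x] * (y - x) ^+ 2 by ring.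
rewrite (le_trans (ler_normD _ _)) // mulrDl lerD // normrM.
  by rewrite -[X in _ <= X]mul1r ler_pM // H.
by rewrite [`|_ ^+ 2|]ger0_norm ?sqr_ge0 // ler_wpM2r ?sqr_ge0 // HB.
Qed.

Lemma poly_lipschitz p : exists2 C : R, 0 <= C & forall x y, `|x| <= 1 -> `|y| <= 1 ->
  `|p.[y] - p.[x]| <= C * `|y - x|.
Proof.
elim/poly_ind: p => [|p c [C C0 H]].
  by exists 0 => // x y _ _; rewrite !horner0 mul0r subr0 normr0.
have [B B0 HB] := poly_bounded p.
exists (C + B); first by rewrite addr_ge0.
move=> x y x1 y1; rewrite !hornerMXaddC.
have -> : p.[y] * y + c - (p.[x] * x + c) = y * (p.[y] - p.[x]) + p.[x] * (y - x) by ring.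
rewrite (le_trans (ler_normD _ _)) // mulrDl lerD // normrM.
  by rewrite -[X in _ <= X]mul1r ler_pM // H.
by rewrite ler_wpM2r // HB.
Qed.

End PolynomialEstimates.

(** * Riemann averages at left endpoints *)

Section RiemannSums.
Variable R : realType.

Definition riemann_avg (N : nat) (f : R -> R) : R :=
  N%:R^-1 * \sum_(i < N) f (i%:R / N%:R).

(** The cutoff at an arbitrary [c], which may lie between two nodes, allows piecewise integration:
    the average over [[x, y)] is a difference of two prefixes. The constant depends only on [C],
    hence it is uniform in [c]. *)
Lemma riemann_prefix (F f : R -> R) (C c : R) (N : nat) :
  (0 < N)%N -> 0 <= C -> 0 <= c <= 1 ->
  (forall t : R, 0 <= t <= 1 -> `|f t| <= C) ->
  (forall t t' : R, 0 <= t <= 1 -> 0 <= t' <= 1 -> `|F t' - F t - f t * (t' - t)| <= C * (t' - t) ^+ 2) ->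
  `|riemann_avg N (fun t => (t < c)%R%:R * f t) - (F c - F 0)| <= 2 * C / N%:R.
Proof.
move=> N0 C0 /andP[c0 c1] fC FC.
have Np : 0 < N%:R :> R by rewrite ltr0n.
have NV : 0 < N%:R^-1 :> R by rewrite invr_gt0.
have iN (i : nat) : (i <= N)%N -> 0 <= (i%:R / N%:R : R) <= 1.
  by move=> h; rewrite divr_ge0 ?ler0n //= ler_pdivrMr // mul1r ler_nat.
(* Every node below [c] costs [C / N ^ 2] by the quadratic remainder. The one whose interval
   contains [c] costs a further [C / N], which is the second summand. *)
have key (j : nat) : (j <= N)%N ->
  `|N%:R^-1 * (\sum_(i < j) (i%:R / N%:R < c)%R%:R * f (i%:R / N%:R)) -
    (F (Num.min c (j%:R / N%:R)) - F 0)|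
   <= j%:R * C / N%:R ^+ 2 + (c < j%:R / N%:R)%R%:R * (C / N%:R).
  elim: j => [|j IH] jN.
    by rewrite big_ord0 mulr0 mul0r min_r // subrr subr0 normr0 !mul0r add0r mulr_ge0 ?divr_ge0 // ltW.
  have {IH} := IH (ltnW jN); rewrite big_ord_recr /=.
  have tjS : j.+1%:R / N%:R = j%:R / N%:R + N%:R^-1 :> R by rewrite -natr1 mulrDl mul1r.
  have /andP[t0 t1] := iN _ (ltnW jN).
  have /andP[s0 s1] := iN _ jN.
  have tS : j%:R * C / N%:R ^+ 2 <= j.+1%:R * C / N%:R ^+ 2.
    by rewrite ler_wpM2r ?invr_ge0 ?exprn_ge0 ?ler0n // ler_wpM2r // ler_nat.
  have [tc|ct] := ltP (j%:R / N%:R) c; last first.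
    rewrite mul0r addr0 ![Num.min c _]min_l //; last by rewrite tjS ler_wpDr // ltW.
    move=> h; apply: (le_trans h); apply: lerD => //.
    rewrite ler_wpM2r ?divr_ge0 // ?ler0n // ler_nat.
    suff -> : c < j.+1%:R / N%:R by case: (_ < _).
    by rewrite tjS; lra.
  rewrite mul1r (lt_gtF tc) mul0r addr0 => h.
  set S := \sum_(i < j) _ in h *; set m := Num.min c _.
  have m01 : 0 <= m <= 1 by rewrite /m le_min c0 s0 ge_min c1.
  have {}FC := FC _ m (iN _ (ltnW jN)) m01.
  have {}fC := fC _ (iN _ (ltnW jN)).
  set t := (j%:R / N%:R) in h FC fC tjS tc t0 t1 *.
  have mt : t <= m <= t + N%:R^-1.
    by rewrite /m tjS le_min ge_min (ltW tc) lexx lerDl (ltW NV) orbT.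
  have -> : N%:R^-1 * (S + f t) - (F m - F 0) =
    (N%:R^-1 * S - (F t - F 0)) - (F m - F t - f t * (m - t)) + f t * (t + N%:R^-1 - m).
    ring.
  apply: le_trans (ler_normD _ _) _; apply: lerD.
    apply: le_trans (ler_normB _ _) _.
    rewrite -natr1 !mulrDl mul1r lerD //.
    apply: le_trans FC _; rewrite ler_wpM2l // -exprVn ler_sqr ?nnegrE; [lra|lra|lra].
  rewrite normrM [X in _ * X]ger0_norm; last by lra.
  have [cs|sc] := ltP c (j.+1%:R / N%:R).
    by rewrite mul1r ler_pM //; lra.
  by rewrite /m min_r // -tjS subrr mulr0 mul0r.
have {key} := key N (leqnn N).
rewrite divff ?gt_eqF // min_l //; set b := (c < 1)%R => /le_trans; apply.
have -> : N%:R * C / N%:R ^+ 2 = C / N%:R by field; rewrite gt_eqF.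
have : 0 <= C / N%:R by rewrite divr_ge0 // ltW.
by case: b => /=; lra.
Qed.

Lemma eq_riemann_avg N (f g : R -> R) : (forall t : R, 0 <= t < 1 -> f t = g t) ->
  riemann_avg N f = riemann_avg N g.
Proof.
move=> fg; congr (_ * _); apply: eq_bigr => -[i iN] _ /=.
have N0 : 0 < N%:R :> R by rewrite ltr0n (leq_trans _ iN).
by rewrite fg // divr_ge0 ?ler0n //= ltr_pdivrMr // mul1r ltr_nat.
Qed.

Lemma riemann_avgD N (f g : R -> R) :
  riemann_avg N (fun t => f t + g t) = riemann_avg N f + riemann_avg N g.
Proof. by rewrite /riemann_avg big_split mulrDr. Qed.

Lemma riemann_avgB N (f g : R -> R) :
  riemann_avg N (fun t => f t - g t) = riemann_avg N f - riemann_avg N g.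
Proof. by rewrite /riemann_avg sumrB mulrBr. Qed.

Lemma riemann_avgZ N c (f : R -> R) :
  riemann_avg N (fun t => c * f t) = c * riemann_avg N f.
Proof. by rewrite /riemann_avg -mulr_sumr mulrCA. Qed.

Lemma riemann_avg_sum N (I : Type) (r : seq I) (P : pred I) (f : I -> R -> R) :
  riemann_avg N (fun t => \sum_(i <- r | P i) f i t) = \sum_(i <- r | P i) riemann_avg N (f i).
Proof. by rewrite /riemann_avg exchange_big mulr_sumr. Qed.

Lemma riemann_prefix_poly (p : {poly R}) : exists2 C : R, 0 <= C &
  forall (N : nat) (c : R), (0 < N)%N -> 0 <= c <= 1 ->
  `|riemann_avg N (fun t => (t < c)%R%:R * p^`().[t]) - (p.[c] - p.[0])| <= C / N%:R.
Proof.
have [C1 C10 H1] := poly_bounded p^`().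
have [C2 C20 H2] := poly_taylor1 p.
have le1 (t : R) : 0 <= t <= 1 -> `|t| <= 1 by move=> /andP[t0 t1]; rewrite ger0_norm.
exists (2 * (C1 + C2)) => [|N c N0 c01]; first by rewrite mulr_ge0 // addr_ge0.
apply: riemann_prefix => // [|t t01|t t' t01 t'01]; first exact: addr_ge0.
  by rewrite (le_trans (H1 _ (le1 _ t01))) // lerDl.
apply: (le_trans (H2 _ _ (le1 _ t01) (le1 _ t'01))).
by rewrite ler_wpM2r ?sqr_ge0 // lerDr.
Qed.

End RiemannSums.

(** * The Bernoulli kernel as a convolution on the circle *)

Section BernoulliConvolution.
Variable R : realType.
Local Notation p := (bernp R).

(* Repeated integration by parts of [p_m(v(t)) p_n(u(t))] when u' = v' = -1. *)
Fixpoint conv_prim (m n : nat) (u v : {poly R}) : {poly R} :=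
  if n is n'.+1 then - ((p m.+1 \Po v) * (p n \Po u)) - conv_prim m.+1 n' u v
  else - (p m.+1 \Po v).

Fixpoint conv_val (m n : nat) (a c : R) : R :=
  if n is n'.+1 then - ((p m.+1).[c] * (p n).[a]) - conv_val m.+1 n' a c
  else - (p m.+1).[c].

Lemma horner_conv_prim m n u v t : (conv_prim m n u v).[t] = conv_val m n u.[t] v.[t].
Proof.
by elim: n m => [|n IH] m /=; rewrite !(hornerN, hornerD, hornerM, horner_comp) ?IH.
Qed.

Lemma deriv_conv_prim m n u v : u^`() = -1 -> v^`() = -1 ->
  (conv_prim m n u v)^`() = (p m \Po v) * (p n \Po u).
Proof.
move=> du dv; elim: n m => [|n IH] m /=.
  by rewrite derivN deriv_comp dv deriv_bernp mulrN1 opprK bernp0 comp_polyC mulr1.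
rewrite derivB derivN derivM !deriv_comp du dv !deriv_bernp IH !mulrN1 mulNr mulrN.
by rewrite opprD !opprK addrK.
Qed.

(** With first index [m.+1], only Bernoulli polynomials of index at least 2 are evaluated at [c], so
    B_1, the only one with different values at 0 and 1, does not occur there. *)
Lemma conv_val_01 m n a : conv_val m.+1 n a 0 = conv_val m.+1 n a 1.
Proof. by elim: n m => [|n IH] m /=; rewrite bernp_01 ?IH. Qed.

(** Between 0 and 1 only B_1 jumps, by exactly 1. It is the factor reached at the last integration
    by parts, when the other index has grown to [m + n.+1]. *)
Lemma conv_val_jump m n c :
  conv_val m n.+1 0 c - conv_val m n.+1 1 c = (-1) ^+ n * (p (m + n.+1)).[c].
Proof.
elim: n m => [|n IH] m.
  by rewrite /= bernp1_01 expr0 mul1r addn1; ring.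
have E d : conv_val m n.+2 d c = - ((p m.+1).[c] * (p n.+2).[d]) - conv_val m.+1 n.+1 d c by [].
by rewrite exprS mulN1r mulNr addnS -addSn -IH !E bernp_01; ring.
Qed.

Definition bern_kernel (alpha : nat) (x y : R) : R :=
  (-1) ^+ alpha.+1 * (p (2 * alpha)).[`|x - y|].

(* B_alpha({x - t}) / alpha! *)
Definition bern_feature (alpha : nat) (x t : R) : R :=
  if t < x then (p alpha).[x - t] else (p alpha).[x - t + 1].

Lemma bern_kernel_limit_le alpha x y : (0 < alpha)%N -> 0 <= x -> x <= y -> y <= 1 ->
  exists2 C : R, 0 <= C & forall N, (0 < N)%N ->
  `|riemann_avg N (fun t => bern_feature alpha x t * bern_feature alpha y t)
     - bern_kernel alpha x y| <= C / N%:R.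
Proof.
case: alpha => // a _ x0 xy y1.
pose lin (z : R) : {poly R} := z%:P - 'X.
have dlin z : (lin z)^`() = -1 by rewrite /lin derivB derivC derivX sub0r.
have hlin z t : (lin z).[t] = z - t by rewrite !hornerE.
(* On [[0, x)] neither [x - t] nor [y - t] wraps around, on [[x, y)] only the first does, on
   [[y, 1)] both do; adding 1 to the linear function accounts for the wrap. *)
pose P1 := conv_prim a.+1 a.+1 (lin x) (lin y).
pose P2 := conv_prim a.+1 a.+1 (lin (x + 1)) (lin y).
pose P3 := conv_prim a.+1 a.+1 (lin (x + 1)) (lin (y + 1)).
have [C1 C10 H1] := riemann_prefix_poly P1.
have [C2 C20 H2] := riemann_prefix_poly P2.
have [C3 C30 H3] := riemann_prefix_poly P3.
exists (C1 + (C2 + C2) + (C3 + C3)); first by rewrite !addr_ge0.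
move=> N N0.
have x01 : 0 <= x <= 1 by rewrite x0 (le_trans xy).
have y01 : 0 <= y <= 1 by rewrite y1 (le_trans x0).
have o01 : 0 <= (1 : R) <= 1 by rewrite ler01 lexx.
pose pre (P : {poly R}) c t : R := (t < c)%R%:R * P^`().[t].
have -> : riemann_avg N (fun t => bern_feature a.+1 x t * bern_feature a.+1 y t) =
   riemann_avg N (pre P1 x) + (riemann_avg N (pre P2 y) - riemann_avg N (pre P2 x))
    + (riemann_avg N (pre P3 1) - riemann_avg N (pre P3 y)).
  rewrite -!riemann_avgB -!riemann_avgD; apply: eq_riemann_avg => t /andP[t0 t1].
  rewrite /pre /P1 /P2 /P3 !deriv_conv_prim // t1 !hornerM !horner_comp !hlin /bern_feature.
  have e z : z - t + 1 = z + 1 - t by rewrite addrAC.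
  rewrite !e; case: (ltP t x) => tx; first by rewrite (lt_le_trans tx xy) !mul1r; ring.
  by case: (ltP t y) => ty; rewrite !(mul1r, mul0r); ring.
(* The values at the ends 0 and 1 coincide, those of [P2] and [P3] at [y] agree by [conv_val_01],
   and only the jump from [P1] to [P2] at [x] survives; it is the kernel. *)
have -> : bern_kernel a.+1 x y = (P1.[x] - P1.[0]) + ((P2.[y] - P2.[0]) - (P2.[x] - P2.[0]))
   + ((P3.[1] - P3.[0]) - (P3.[y] - P3.[0])).
  rewrite /P1 /P2 /P3 !horner_conv_prim !hlin /bern_kernel.
  rewrite distrC ger0_norm ?subr_ge0 // mul2n -addnn !exprS !mulN1r opprK.
  rewrite -conv_val_jump !subr0 (_ : x + 1 - x = 1); last by ring.
  rewrite (_ : x + 1 - 1 = x); last by ring.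
  rewrite (_ : y + 1 - 1 = y); last by ring.
  rewrite (_ : y + 1 - y = 1); last by ring.
  by rewrite !subrr conv_val_01; ring.
have h1 := H1 N _ N0 x01; have h2x := H2 N _ N0 x01; have h2y := H2 N _ N0 y01.
have h3y := H3 N _ N0 y01; have h31 := H3 N _ N0 o01.
move: h1 h2x h2y h3y h31; rewrite -/(pre P1 x) -/(pre P2 x) -/(pre P2 y) -/(pre P3 y) -/(pre P3 1).
rewrite !mulrDl !ler_norml; lra.
Qed.

Lemma bern_kernelC alpha x y : bern_kernel alpha x y = bern_kernel alpha y x.
Proof. by rewrite /bern_kernel distrC. Qed.

Lemma bern_kernel_limit alpha x y : (0 < alpha)%N -> 0 <= x <= 1 -> 0 <= y <= 1 ->
  exists2 C : R, 0 <= C & forall N, (0 < N)%N ->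
  `|riemann_avg N (fun t => bern_feature alpha x t * bern_feature alpha y t)
     - bern_kernel alpha x y| <= C / N%:R.
Proof.
move=> a0 /andP[x0 x1] /andP[y0 y1].
have [xy|/ltW yx] := leP x y; first exact: bern_kernel_limit_le.
have [C C0 H] := bern_kernel_limit_le a0 y0 yx x1.
exists C => // N N0; rewrite bern_kernelC.
by have := H N N0; congr (`|_ - _| <= _); apply: eq_riemann_avg => t _; rewrite mulrC.
Qed.

(** The kernel has mean zero: splitting at the kink [t = y], the antiderivative [q] of odd index
    satisfies [q(0) = 0] and [q(1 - y) = - q(y)], so the boundary terms cancel. The constant is
    independent of [y] because the estimate is later applied at all nodes of a growing grid. *)
Lemma riemann_avg_bern_kernel alpha : (0 < alpha)%N -> exists2 C : R, 0 <= C &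
  forall N (y : R), (0 < N)%N -> 0 <= y <= 1 ->
  `|riemann_avg N (fun t => bern_kernel alpha t y)| <= C / N%:R.
Proof.
move=> a0; pose q := p (2 * alpha).+1.
have dq : q^`() = p (2 * alpha) by rewrite deriv_bernp.
have [C1 C10 H1] := poly_bounded q^`().
have [C2 C20 H2] := poly_taylor1 q.
pose C := C1 + C2.
have C0 : 0 <= C by rewrite addr_ge0.
exists (2 * C + 2 * C + 2 * C) => [|N y N0 y01]; first by lra.
have /andP[y0 y1] := y01.
have in1 (t : R) : 0 <= t <= 1 -> `|y - t| <= 1 /\ `|t - y| <= 1.
  by move=> /andP[t0 t1]; rewrite distrC; split; rewrite ler_norml; lra.
have pre_le (c : R) : 0 <= c <= 1 ->
   `|riemann_avg N (fun t => (t < c)%R%:R * q^`().[t - y]) - (q.[c - y] - q.[0 - y])| <= 2 * C / N%:R.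
  move=> c01; apply: (@riemann_prefix _ (fun t => q.[t - y])) => // [t|t t'] t01.
    by rewrite (le_trans (H1 _ (in1 _ t01).2)) // lerDl.
  move=> t'01; have := H2 _ _ (in1 _ t01).2 (in1 _ t'01).2.
  rewrite (_ : t' - y - (t - y) = t' - t); last by ring.
  by move=> /le_trans; apply; rewrite ler_wpM2r ?sqr_ge0 // lerDr.
have post_le : `|riemann_avg N (fun t => (t < y)%R%:R * q^`().[y - t])
    - (- q.[y - y] - - q.[y - 0])| <= 2 * C / N%:R.
  apply: (@riemann_prefix _ (fun t => - q.[y - t])) => // [t|t t'] t01.
    by rewrite (le_trans (H1 _ (in1 _ t01).1)) // lerDl.
  move=> t'01; have := H2 _ _ (in1 _ t01).1 (in1 _ t'01).1.
  rewrite (_ : q.[y - t'] - q.[y - t] - q^`().[y - t] * (y - t' - (y - t)) =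
    - (- q.[y - t'] - - q.[y - t] - q^`().[y - t] * (t' - t))); last by ring.
  rewrite normrN (_ : y - t' - (y - t) = - (t' - t)) ?sqrrN; last by ring.
  by move=> /le_trans; apply; rewrite ler_wpM2r ?sqr_ge0 // lerDr.
have o01 : 0 <= (1 : R) <= 1 by rewrite ler01 lexx.
have h1 := pre_le _ o01; have hy := pre_le _ y01.
rewrite riemann_avgZ normrM normrX normrN1 expr1n mul1r.
rewrite (_ : riemann_avg N _ = riemann_avg N (fun t => (t < y)%R%:R * q^`().[y - t]) +
   (riemann_avg N (fun t => (t < 1)%R%:R * q^`().[t - y]) -
    riemann_avg N (fun t => (t < y)%R%:R * q^`().[t - y]))); last first.
  rewrite -riemann_avgB -riemann_avgD; apply: eq_riemann_avg => t /andP[t0 t1].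
  rewrite t1 dq; have [ty|yt] := ltP t y.
    by rewrite distrC ger0_norm ?subr_ge0 ?ltW // !mul1r; ring.
  by rewrite ger0_norm ?subr_ge0 // !(mul1r, mul0r); ring.
have q0 : q.[0] = 0 by exact: bernp_odd0.
have qr : q.[1 - y] = - q.[y].
  by rewrite /q bernp_reflect exprS exprM sqrrN expr1n expr1n mulr1 mulN1r.
move: h1 hy post_le; rewrite !subrr q0 qr subr0 !ler_norml !mulrDl; lra.
Qed.

End BernoulliConvolution.

Lemma le_div_natr (R : realType) (C e : R) : 0 <= C -> 0 < e ->
  exists N0, forall N, (N0 < N)%N -> C / N%:R <= e.
Proof.
move=> C0 e0; exists (Num.bound (C / e)) => N hN.
have N0 : 0 < N%:R :> R by rewrite ltr0n (leq_ltn_trans _ hN).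
rewrite ler_pdivrMr // mulrC -ler_pdivrMr //.
apply: le_trans (ltW (archi_boundP _)) _; first by rewrite divr_ge0 // ltW.
by rewrite ler_nat ltnW.
Qed.

Lemma avg_near (R : numFieldType) n (F : 'I_n -> R) (c e : R) : (0 < n)%N ->
  (forall h, `|F h - c| <= e) -> `|n%:R^-1 * \sum_h F h - c| <= e.
Proof.
move=> n0 hF; have np : 0 < n%:R :> R by rewrite ltr0n.
rewrite (_ : _ - c = n%:R^-1 * \sum_h (F h - c)); last first.
  by rewrite sumrB sumr_const card_ord mulrBr -[c *+ n]mulr_natl mulKf // gt_eqF.
rewrite normrM gtr0_norm ?invr_gt0 // mulrC ler_pdivrMr //.
apply: le_trans (ler_norm_sum _ _ _) _.
have -> : e * n%:R = \sum_(k < n) e by rewrite sumr_const card_ord mulr_natr.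
exact: ler_sum.
Qed.

(** * Positive semidefinite matrices *)

Section PositiveSemidefinite.
Variable R : realType.

Definition psd n (M : 'I_n -> 'I_n -> R) :=
  forall c : 'I_n -> R, 0 <= \sum_i \sum_j c i * c j * M i j.

(** A Schur product with a rank-one matrix merely rescales the test vector; sums and entrywise
    limits extend this to every factor of the kernel. *)
Lemma psd_rank1M n (a : 'I_n -> R) M : psd M -> psd (fun i j => a i * a j * M i j).
Proof.
move=> hM c; have := hM (fun i => c i * a i); congr (_ <= _).
by apply: eq_bigr => i _; apply: eq_bigr => j _; ring.
Qed.

Lemma psdD n (M M' : 'I_n -> 'I_n -> R) : psd M -> psd M' -> psd (fun i j => M i j + M' i j).
Proof.
move=> hM hM' c; have := addr_ge0 (hM c) (hM' c); rewrite -big_split /=; congr (_ <= _).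
by apply: eq_bigr => i _; rewrite -big_split; apply: eq_bigr => j _; rewrite mulrDr.
Qed.

Lemma psdZ n g (M : 'I_n -> 'I_n -> R) : 0 <= g -> psd M -> psd (fun i j => g * M i j).
Proof.
move=> g0 hM c; have := mulr_ge0 g0 (hM c); rewrite mulr_sumr; congr (_ <= _).
by apply: eq_bigr => i _; rewrite mulr_sumr; apply: eq_bigr => j _; rewrite mulrCA.
Qed.

Lemma psd0 n : psd (fun _ _ : 'I_n => 0).
Proof. by move=> c; rewrite big1 // => i _; rewrite big1 // => j _; rewrite mulr0. Qed.

Lemma eq_psd n (M M' : 'I_n -> 'I_n -> R) : (forall i j, M i j = M' i j) -> psd M -> psd M'.
Proof.
by move=> e h c; under eq_bigr => i _ do under eq_bigr => j _ do rewrite -e; exact: h.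
Qed.

Lemma psd_sum n (I : Type) (r : seq I) (M : I -> 'I_n -> 'I_n -> R) :
  (forall k, psd (M k)) -> psd (fun i j => \sum_(k <- r) M k i j).
Proof.
move=> h; elim: r => [|k r IH].
  by apply: eq_psd (@psd0 n) => i j; rewrite big_nil.
by apply: eq_psd (psdD (h k) IH) => i j; rewrite big_cons.
Qed.

Lemma psd_limit n (M : 'I_n -> 'I_n -> R) :
  (forall e : R, 0 < e -> exists2 M', psd M' & forall i j, `|M' i j - M i j| <= e) -> psd M.
Proof.
move=> h c; rewrite leNgt; apply/negP; set S := (X in X < 0) => S0.
pose A := \sum_i \sum_j `|c i * c j|.
have A0 : 0 <= A by apply: sumr_ge0 => i _; apply: sumr_ge0.
(* This tolerance changes the quadratic form by less than [- S], so a negative [S] would remain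
   negative; [A + 1] keeps the denominator nonzero. *)
have [|M' hM' hM] := h (- S / (2 * (A + 1))); first by rewrite divr_gt0 //; lra.
have := hM' c; set S' := (X in 0 <= X) => S'0.
have : `|S' - S| <= A * (- S / (2 * (A + 1))).
  rewrite /S' /S -sumrB mulr_suml; apply: le_trans (ler_norm_sum _ _ _) _.
  apply: ler_sum => i _; rewrite -sumrB mulr_suml; apply: le_trans (ler_norm_sum _ _ _) _.
  by apply: ler_sum => j _; rewrite -mulrBr normrM ler_wpM2l.
have -> : A * (- S / (2 * (A + 1))) = - S / 2 * (A / (A + 1)) by field; lra.
have : A / (A + 1) <= 1 by rewrite ler_pdivrMr; lra.
move: (A / _) => B B1 /(le_trans (ler_norm _)) hh.
have : - S / 2 * B <= - S / 2 by rewrite -[X in _ <= X]mulr1 ler_wpM2l //; lra.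
lra.
Qed.

End PositiveSemidefinite.

(** * The one-dimensional kernel and the positivity of the product kernel *)

Section Kernel.
Variable R : realType.
Implicit Types (alpha : nat) (x y : R).

Lemma K1E alpha x y : K1 alpha x y =
  \sum_(1 <= t < alpha.+1) (bernp R t).[x] * (bernp R t).[y] + bern_kernel alpha x y.
Proof.
rewrite /K1 /bern_kernel !horner_bernp mulrA; congr (_ + _).
apply: eq_bigr => t _; rewrite !horner_bernp.
by field; rewrite pnatr_eq0 -lt0n fact_gt0.
Qed.

Lemma K1C alpha x y : K1 alpha x y = K1 alpha y x.
Proof. by rewrite !K1E bern_kernelC; congr (_ + _); apply: eq_bigr => t _; rewrite mulrC. Qed.

(** The multiplier [M] stands for the coordinates already treated, so that the product kernel can be
    built one factor at a time. *)
Lemma psd_mul_bern_kernel n alpha (M : 'I_n -> 'I_n -> R) (x : 'I_n -> R) :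
  (0 < alpha)%N -> (forall i, 0 <= x i <= 1) -> psd M ->
  psd (fun i j => bern_kernel alpha (x i) (x j) * M i j).
Proof.
move=> a0 x01 hM; apply: psd_limit => e e0.
have /choice[C HC] : forall ij : 'I_n * 'I_n, exists C : R, 0 <= C /\ forall N, (0 < N)%N ->
  `|riemann_avg N (fun t => bern_feature alpha (x ij.1) t * bern_feature alpha (x ij.2) t)
     - bern_kernel alpha (x ij.1) (x ij.2)| <= C / N%:R.
  move=> [i j]; have [C C0 H] := bern_kernel_limit a0 (x01 i) (x01 j).
  by exists C; split.
(* One constant dominating all entries, so that a single grid size serves the whole matrix. *)
pose B := \sum_ij C ij * `|M ij.1 ij.2|.
have leB i j : C (i, j) * `|M i j| <= B.
  rewrite /B (bigD1 (i, j)) //= lerDl sumr_ge0 // => ij _.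
  by rewrite mulr_ge0 //; case: (HC ij).
have B0 : 0 <= B by apply: sumr_ge0 => ij _; rewrite mulr_ge0 //; case: (HC ij).
have [N1 /(_ N1.+1 (ltnSn _)) NB] := le_div_natr B0 e0.
set N := N1.+1 in NB.
have N0 : 0 < N%:R :> R by rewrite ltr0n.
exists (fun i j => riemann_avg N (fun t => bern_feature alpha (x i) t * bern_feature alpha (x j) t) * M i j).
  apply: (@eq_psd _ _ (fun i j => N%:R^-1 * \sum_(k < N) bern_feature alpha (x i) (k%:R / N%:R) *
     bern_feature alpha (x j) (k%:R / N%:R) * M i j)).
    by move=> i j; rewrite /riemann_avg -mulr_suml mulrA.
  apply: psdZ; first by rewrite invr_ge0 ltW.
  by apply: psd_sum => k; apply: psd_rank1M.
move=> i j; rewrite -mulrBl normrM.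
have := (HC (i, j)).2 N isT; rewrite /= => h.
apply: le_trans (ler_wpM2r (normr_ge0 _) h) _.
by apply: le_trans NB; rewrite mulrAC ler_wpM2r // invr_ge0 ltW.
Qed.

Lemma psd_mul_K1 n alpha g (M : 'I_n -> 'I_n -> R) (x : 'I_n -> R) :
  (0 < alpha)%N -> 0 <= g -> (forall i, 0 <= x i <= 1) -> psd M ->
  psd (fun i j => (1 + g * K1 alpha (x i) (x j)) * M i j).
Proof.
move=> a0 g0 x01 hM.
apply: (@eq_psd _ _ (fun i j => M i j + g * (\sum_(t <- index_iota 1 alpha.+1)
   (bernp R t).[x i] * (bernp R t).[x j] * M i j + bern_kernel alpha (x i) (x j) * M i j))).
  by move=> i j; rewrite K1E -mulr_suml; ring.
apply: psdD => //; apply: psdZ => //; apply: psdD; last exact: psd_mul_bern_kernel.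
by apply: psd_sum => t; apply: psd_rank1M.
Qed.

Lemma psd_Kalpha n s alpha (gamma : 'I_s -> R) (x : 'I_n -> 'I_s -> R) :
  (0 < alpha)%N -> (forall j, 0 <= gamma j) -> (forall i, cube (x i)) ->
  psd (fun i j => Kalpha alpha gamma (x i) (x j)).
Proof.
move=> a0 g0 hx; rewrite /Kalpha; elim: (index_enum _) => [|k r IH].
  apply: (@eq_psd _ _ (fun _ _ => 1)) => [i j|c]; first by rewrite big_nil.
  rewrite (_ : \sum_i _ = (\sum_i c i) ^+ 2) ?sqr_ge0 //.
  rewrite expr2 mulr_suml; apply: eq_bigr => i _; rewrite mulr_sumr.
  by apply: eq_bigr => j _; rewrite mulr1.
apply: (@eq_psd _ _ (fun i j => (1 + gamma k * K1 alpha (x i k) (x j k)) *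
   \prod_(l <- r) (1 + gamma l * K1 alpha (x i l) (x j l)))).
  by move=> i j; rewrite big_cons.
by apply: psd_mul_K1 => // i; apply: hx.
Qed.

Lemma K1_bounded alpha : exists2 C : R, 0 <= C &
  forall x y, 0 <= x <= 1 -> 0 <= y <= 1 -> `|K1 alpha x y| <= C.
Proof.
have hb (t : nat) : exists C : R, 0 <= C /\ forall x, `|x| <= 1 -> `|(bernp R t).[x]| <= C.
  by have [C C0 H] := poly_bounded (bernp R t); exists C.
have /choice[B HB] := hb.
have B0 t : 0 <= B t by case: (HB t).
exists (\sum_(1 <= t < alpha.+1) B t * B t + B (2 * alpha)%N).
  by rewrite addr_ge0 ?sumr_ge0 // => *; rewrite ?mulr_ge0.
have le1 (z : R) : 0 <= z <= 1 -> `|z| <= 1 by move=> /andP[z0 z1]; rewrite ger0_norm.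
move=> x y x01 y01; rewrite K1E; apply: le_trans (ler_normD _ _) _; apply: lerD.
  apply: le_trans (ler_norm_sum _ _ _) _; apply: ler_sum => t _.
  by rewrite normrM ler_pM //; apply: (HB t).2; apply: le1.
rewrite normrM normrX normrN1 expr1n mul1r; apply: (HB _).2.
by rewrite normr_id ler_norml; lra.
Qed.

Lemma K1_lipschitz alpha : exists2 C : R, 0 <= C &
  forall x y x' y', 0 <= x <= 1 -> 0 <= y <= 1 -> 0 <= x' <= 1 -> 0 <= y' <= 1 ->
  `|K1 alpha x y - K1 alpha x' y'| <= C * (`|x - x'| + `|y - y'|).
Proof.
have hb (t : nat) : exists C : R, 0 <= C /\ forall x, `|x| <= 1 -> `|(bernp R t).[x]| <= C.
  by have [C C0 H] := poly_bounded (bernp R t); exists C.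
have hl (t : nat) : exists C : R, 0 <= C /\ forall x y, `|x| <= 1 -> `|y| <= 1 ->
    `|(bernp R t).[y] - (bernp R t).[x]| <= C * `|y - x|.
  by have [C C0 H] := poly_lipschitz (bernp R t); exists C.
have /choice[B HB] := hb.
have B0 t : 0 <= B t by case: (HB t).
have /choice[L HL] := hl.
have L0 t : 0 <= L t by case: (HL t).
exists (\sum_(1 <= t < alpha.+1) L t * B t + L (2 * alpha)%N).
  by rewrite addr_ge0 ?sumr_ge0 // => *; rewrite ?mulr_ge0.
have le1 (z : R) : 0 <= z <= 1 -> `|z| <= 1 by move=> /andP[z0 z1]; rewrite ger0_norm.
move=> x y x' y' x01 y01 x'01 y'01; rewrite !K1E opprD addrACA -sumrB.
apply: le_trans (ler_normD _ _) _; rewrite mulrDl; apply: lerD.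
  apply: le_trans (ler_norm_sum _ _ _) _; rewrite mulr_suml; apply: ler_sum => t _.
  set P := bernp R t.
  have -> : P.[x] * P.[y] - P.[x'] * P.[y'] =
     (P.[x] - P.[x']) * P.[y] + P.[x'] * (P.[y] - P.[y']) by ring.
  apply: le_trans (ler_normD _ _) _; rewrite [X in _ <= X]mulrDr !normrM; apply: lerD.
    rewrite mulrAC ler_pM //; first by apply: (HL t).2; exact: le1.
    by apply: (HB t).2; exact: le1.
  rewrite -mulrA mulrCA ler_pM //; first by apply: (HB t).2; exact: le1.
  by apply: (HL t).2; exact: le1.
rewrite -mulrBr normrM normrX normrN1 expr1n mul1r.
have n1 (a c : R) : 0 <= a <= 1 -> 0 <= c <= 1 -> `| `|a - c| | <= 1.
  by move=> h h'; rewrite normr_id ler_norml; lra.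
apply: le_trans ((HL _).2 _ _ (n1 _ _ x'01 y'01) (n1 _ _ x01 y01)) _.
rewrite ler_wpM2l //.
apply: le_trans (ler_dist_dist _ _) _.
rewrite (_ : x - y - (x' - y') = (x - x') - (y - y')); last by ring.
exact: ler_normB.
Qed.

Lemma riemann_avg_K1 alpha : (0 < alpha)%N -> exists2 C : R, 0 <= C &
  forall N y, (0 < N)%N -> 0 <= y <= 1 -> `|riemann_avg N (fun t => K1 alpha t y)| <= C / N%:R.
Proof.
move=> a0; have [C1 C10 H1] := riemann_avg_bern_kernel R a0.
have /choice[B HB] : forall t : nat, exists C : R, 0 <= C /\ forall x, `|x| <= 1 -> `|(bernp R t).[x]| <= C.
  by move=> t; have [C C0 H] := poly_bounded (bernp R t); exists C.
(* [E t] belongs to [bernp t.+1], because [bernp 0] has mean 1. For the others the mean vanishes: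
   the antiderivative has equal values at 0 and 1. *)
have /choice[E HE] : forall t : nat, exists C : R, 0 <= C /\ forall N, (0 < N)%N ->
    `|riemann_avg N (fun z => (bernp R t.+1).[z])| <= C / N%:R.
  move=> t; have [C C0 H] := riemann_prefix_poly (bernp R t.+2); exists C; split => // N N0.
  have := H N 1 N0; rewrite bernp_01 subrr subr0 deriv_bernp ler01 lexx => /(_ isT).
  by congr (`|_| <= _); apply: eq_riemann_avg => z /andP[_ z1]; rewrite z1 mul1r.
exists (\sum_(1 <= t < alpha.+1) E t.-1 * B t + C1).
  by rewrite addr_ge0 ?sumr_ge0 // => *; rewrite mulr_ge0 //; [apply: (HE _).1|apply: (HB _).1].
move=> N y N0 y01.
rewrite (_ : riemann_avg N _ = \sum_(1 <= t < alpha.+1)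
   (bernp R t).[y] * riemann_avg N (fun z => (bernp R t).[z]) +
   riemann_avg N (fun z => bern_kernel alpha z y)); last first.
  under eq_bigr => t _ do rewrite -riemann_avgZ.
  rewrite -riemann_avg_sum -riemann_avgD; apply: eq_riemann_avg => z _.
  by rewrite K1E; congr (_ + _); apply: eq_bigr => t _; rewrite mulrC.
apply: le_trans (ler_normD _ _) _; rewrite mulrDl; apply: lerD; last exact: H1.
apply: le_trans (ler_norm_sum _ _ _) _; rewrite mulr_suml big_nat [X in _ <= X]big_nat.
apply: ler_sum => -[//|t] _.
rewrite normrM [_.-1]/= mulrC mulrAC ler_pM //; first exact: (HE t).2.
by apply: (HB _).2; case/andP: y01 => y0 y1; rewrite ger0_norm.
Qed.

End Kernel.

(** * Lebesgue integrals squeezed between step functions *)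

Section RiemannIntegration.
Variable R : realType.
Local Notation mu := (@lebesgue_measure R).

(* No measurability is needed: the integral of a nonnegative function is a
   supremum over the simple functions below it. *)
Lemma le_integral_pointwise (D : set R) (f g : R -> \bar R) :
  (forall x, D x -> (f x <= g x)%E) ->
  (\int[mu]_(x in D) f x <= \int[mu]_(x in D) g x)%E.
Proof.
move=> fg.
have fgD x : ((f \_ D) x <= (g \_ D) x)%E.
  by rewrite /patch; case: ifPn => // /set_mem /fg.
rewrite /integral; apply: leeB; apply: ereal_sup_le => _ [h hf <-]; exists h => // x;
  apply: le_trans (hf x) _.
  by rewrite !funeposE; rewrite ge_max !le_max fgD lexx orbT.
by rewrite !funenegE; rewrite ge_max !le_max leeN2 fgD lexx orbT.
Qed.

Definition cell (N i : nat) : set R := [set x | i%:R / N%:R <= x < i.+1%:R / N%:R].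

Lemma measurable_I01 : measurable (@I01 R).
Proof.
rewrite (_ : I01 = `[0, 1]%classic); first exact: measurable_itv.
by apply/seteqP; split => x /=; rewrite /I01 /= in_itv.
Qed.

Lemma cellE N i : cell N i = `[i%:R / N%:R, i.+1%:R / N%:R[%classic.
Proof. by apply/seteqP; split => x /=; rewrite in_itv. Qed.

Lemma cell_sub_I01 N i : (i < N)%N -> cell N i `<=` I01.
Proof.
move=> iN x /andP[h1 h2]; have N0 : 0 < N%:R :> R by rewrite ltr0n (leq_trans _ iN).
rewrite /I01 /= (le_trans _ h1) ?divr_ge0 ?ler0n //=; apply: le_trans (ltW h2) _.
by rewrite ler_pdivrMr // mul1r ler_nat.
Qed.

Lemma ltn_of_cell N i j (x : R) : cell N i x -> cell N j x -> (i <= j)%N.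
Proof.
case: N => [|N]; first by rewrite /cell /= !invr0 !mulr0 => /andP[h /(le_lt_trans h)]; rewrite ltxx.
move=> /andP[h1 h2] /andP[h3 h4]; have := le_lt_trans h1 h4.
by rewrite ltr_pM2r ?invr_gt0 ?ltr0n // ltr_nat.
Qed.

Lemma cell_inj N i j (x : R) : cell N i x -> cell N j x -> i = j.
Proof. by move=> h h'; apply/eqP; rewrite eqn_leq (ltn_of_cell h h') (ltn_of_cell h' h). Qed.

Lemma I01_cell N (x : R) : (0 < N)%N -> I01 x -> x = 1 \/ exists2 i, (i < N)%N & cell N i x.
Proof.
move=> N0 /andP[x0 x1]; have [->|xn1] := eqVneq x 1; [by left|right].
have Np : 0 < N%:R :> R by rewrite ltr0n.
have xN0 : 0 <= x * N%:R by rewrite mulr_ge0.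
have /andP[t1 t2] := Num.Theory.truncn_itv xN0.
exists (Num.trunc (x * N%:R)); last by rewrite /cell /= ler_pdivrMr // ltr_pdivlMr // t1.
rewrite -(ltr_nat R) (le_lt_trans t1) // -[X in _ < X]mul1r ltr_pM2r //.
by rewrite lt_neqAle xn1.
Qed.

Lemma integral_cell N i : (i < N)%N -> (\int[mu]_(x in I01) (\1_(cell N i) x)%:E = (N%:R^-1)%:E)%E.
Proof.
move=> iN; have N0 : 0 < N%:R :> R by rewrite ltr0n (leq_trans _ iN).
rewrite integral_indic; [|exact: measurable_I01|by rewrite cellE; exact: measurable_itv].
rewrite setIidl; last exact: cell_sub_I01.
rewrite cellE; apply: etrans (lebesgue_measure_itv _) _.
rewrite /= lte_fin ltr_pM2r ?invr_gt0 // ltr_nat ltnSn.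
by rewrite -EFinB -mulrBl -natr1 addrAC subrr add0r mul1r.
Qed.

Lemma integrable_itv_I01 (a c : R) (s t : bool) :
  mu.-integrable I01 (fun x => (\1_[set` Interval (BSide s a) (BSide t c)] x)%:E).
Proof.
by apply: integrableS (integrable_indic_itv a c s t) => //; exact: measurable_I01.
Qed.

(* The point 1 lies in no cell; it gets the arbitrary value [d]. *)
Definition step_fun N (c : nat -> R) (d : R) (x : R) : \bar R :=
  (\sum_(i < N) (c i)%:E * (\1_(cell N i) x)%:E + d%:E * (\1_[set` `[1%R, 1%R]] x)%:E)%E.

Lemma integral_step_fun N c d :
  (\int[mu]_(x in I01) step_fun N c d x = (N%:R^-1 * \sum_(i < N) c i)%:E)%E.
Proof.
have m01 := measurable_I01.
have ic (i : 'I_N) : mu.-integrable I01 (fun x => (c i)%:E * (\1_(cell N i) x)%:E)%E.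
  by apply: integrableZl => //; rewrite cellE; exact: integrable_itv_I01.
rewrite integralD //; [|exact: integrable_sum|by apply: integrableZl => //; exact: integrable_itv_I01].
rewrite integral_sum // integralZl //; last exact: integrable_itv_I01.
rewrite [X in (_ + d%:E * X)%E](_ : _ = 0%E); last first.
  apply: etrans (integral_indic _ _ _) _ => //; apply/eqP; rewrite eq_le measure_ge0 andbT.
  have e1 : mu [set` `[1%R : R, 1%R]] = 0%E by rewrite lebesgue_measure_itv /= ltxx.
  by rewrite -[X in (_ <= X)%E]e1; apply: le_measure; rewrite ?inE //; apply: measurableI.
rewrite mule0 adde0 mulr_sumr -sumEFin; apply: eq_bigr => i _.
rewrite integralZl //; last by rewrite cellE; exact: integrable_itv_I01.
by rewrite integral_cell // -EFinM mulrC.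
Qed.

Lemma step_fun_cell N c d i x : (i < N)%N -> cell N i x -> step_fun N c d x = (c i)%:E.
Proof.
move=> iN xi; rewrite /step_fun (bigD1 (Ordinal iN)) //= big1; last first.
  move=> j ji; rewrite indicE memNset ?mule0 // => xj.
  by move/eqP: ji; apply; apply: val_inj => /=; apply: cell_inj xj xi.
rewrite indicE mem_set // mule1 adde0 indicE memNset ?mule0 ?adde0 //=.
rewrite in_itv /= => /andP[x1 _]; have /andP[_ xlt] := xi.
have N0 : 0 < N%:R :> R by rewrite ltr0n (leq_trans _ iN).
have := le_lt_trans x1 xlt; rewrite ltr_pdivlMr // mul1r ltr_nat ltnS leqNgt.
by rewrite iN.
Qed.

Lemma step_fun1 N c d : step_fun N c d 1 = d%:E.
Proof.
rewrite /step_fun big1 => [|[i iN] _ /=].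
  by rewrite add0e indicE mem_set ?mule1 //= in_itv /= lexx.
rewrite indicE memNset ?mule0 // => /andP[_].
have N0 : 0 < N%:R :> R by rewrite ltr0n (leq_trans _ iN).
by rewrite ltr_pdivlMr // mul1r ltr_nat ltnS leqNgt iN.
Qed.

(** On the cells [h] lies between the step functions [c - e] and [c + e]; both get the value [h 1]
    at the point 1, which no cell contains. Their integrals are finite, which also rules out an
    infinite integral of [h]. *)
Lemma Rintegral_cells N (h : R -> R) (c : nat -> R) (e : R) : (0 < N)%N ->
  (forall i x, (i < N)%N -> cell N i x -> `|h x - c i| <= e) ->
  `|\int[mu]_(x in I01) h x - N%:R^-1 * \sum_(i < N) c i| <= e.
Proof.
move=> N0 hc.
have Np : N%:R != 0 :> R by rewrite pnatr_eq0 -lt0n.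
have U : (\int[mu]_(x in I01) (h x)%:E <=
   \int[mu]_(x in I01) step_fun N (fun i => c i + e)%R (h 1%R) x)%E.
  apply: le_integral_pointwise => x /(I01_cell N0)[->|[i iN xi]]; first by rewrite step_fun1.
  by rewrite (step_fun_cell _ _ iN xi) lee_fin -lerBlDl; apply: le_trans (ler_norm _) (hc _ _ iN xi).
have L : (\int[mu]_(x in I01) step_fun N (fun i => c i - e)%R (h 1%R) x <=
   \int[mu]_(x in I01) (h x)%:E)%E.
  apply: le_integral_pointwise => x /(I01_cell N0)[->|[i iN xi]]; first by rewrite step_fun1.
  rewrite (step_fun_cell _ _ iN xi) lee_fin lerBlDl -lerBlDr.
  by apply: le_trans (ler_norm _) _; rewrite distrC; exact: hc.
rewrite /Rintegral; move: U L; rewrite !integral_step_fun.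
case: (\int[mu]_(x in I01) (h x)%:E)%E => //= r; rewrite !lee_fin.
rewrite big_split sumrB sumr_const card_ord mulrDr mulrBr -[e *+ N]mulr_natl mulKf //.
by rewrite ler_norml => U L; apply/andP; split; lra.
Qed.

End RiemannIntegration.

(** * Iterated integrals and averages over product grids *)

Section GridAverages.
Variable R : realType.

Lemma grid_pt_in01 N i : (i < N)%N -> 0 <= (i%:R / N%:R : R) <= 1.
Proof.
move=> iN; have N0 : 0 < N%:R :> R by rewrite ltr0n (leq_trans _ iN).
by rewrite divr_ge0 ?ler0n //= ler_pdivrMr // mul1r ler_nat ltnW.
Qed.

Definition upd (n : nat) (t : R) (x : nat -> R) : nat -> R :=
  fun i => if i == n then t else x i.

(** A list of nodes, so that a grid average is directly a finite combination of point evaluations;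
    the recursion updates the last coordinate outermost, as [iter_int] does. *)
Fixpoint grid (N n : nat) : seq (nat -> R) :=
  if n is n'.+1 then
    [seq upd n' (k%:R / N%:R) x | k <- iota 0 N, x <- grid N n']
  else [:: fun=> 0].

Definition grid_avg N n (f : (nat -> R) -> R) : R := N%:R ^- n * \sum_(x <- grid N n) f x.

Lemma grid_avgS N n f :
  grid_avg N n.+1 f = N%:R^-1 * \sum_(k < N) grid_avg N n (fun x => f (upd n (k%:R / N%:R) x)).
Proof.
rewrite /grid_avg /= big_allpairs_dep /= -{2}(subn0 N) big_mkord -mulr_sumr mulrA.
by rewrite exprS invfM.
Qed.

Lemma eq_grid_avg N n f f' : (forall x, f x = f' x) -> grid_avg N n f = grid_avg N n f'.
Proof. by move=> e; congr (_ * _); apply: eq_bigr. Qed.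

Lemma grid_avgD N n f f' : grid_avg N n (fun x => f x + f' x) = grid_avg N n f + grid_avg N n f'.
Proof. by rewrite /grid_avg big_split mulrDr. Qed.

Lemma grid_avgZ N n c f : grid_avg N n (fun x => c * f x) = c * grid_avg N n f.
Proof. by rewrite /grid_avg -mulr_sumr mulrCA. Qed.

Lemma grid_avg_near N n f (c e : R) : (0 < N)%N ->
  (forall x, (forall i, (i < n)%N -> 0 <= x i <= 1) -> `|f x - c| <= e) ->
  `|grid_avg N n f - c| <= e.
Proof.
move=> N0; elim: n f => [|n IH] f hf.
  by rewrite /grid_avg /= big_seq1 expr0 invr1 mul1r; apply: hf.
rewrite grid_avgS; apply: avg_near => // k; apply: IH => x hx; apply: hf => i iS; rewrite /upd.
case: eqP => [_|/eqP ine]; last by apply: hx; rewrite ltn_neqAle ine.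
exact: grid_pt_in01.
Qed.

Lemma grid_avg_prod N n (G : nat -> R -> R) :
  grid_avg N n (fun x => \prod_(j < n) G j (x j)) = \prod_(j < n) riemann_avg N (G j).
Proof.
elim: n => [|n IH].
  by rewrite /grid_avg /= big_seq1 expr0 invr1 mul1r !big_ord0.
rewrite grid_avgS big_ord_recr /= -IH /riemann_avg [RHS]mulrCA [in RHS]mulr_sumr; congr (_ * _).
apply: eq_bigr => k _; rewrite [RHS]mulrC -grid_avgZ; apply: eq_grid_avg => x.
rewrite big_ord_recr /= mulrC [upd n _ x n]/upd eqxx; congr (_ * _); apply: eq_bigr => j _.
by rewrite /upd ltn_eqF.
Qed.

Lemma grid_in01 N n : (0 < N)%N -> all (fun x => `[< forall i, 0 <= x i <= 1 >]) (grid N n).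
Proof.
move=> N0; elim: n => [|n IH] /=; first by rewrite andbT; apply/asboolP => i; rewrite lexx ler01.
have : all (fun k => k < N)%N (iota 0 N) by apply/allP => k; rewrite mem_iota.
elim: (iota 0 N) => // k r IHr /= /andP[kN /IHr{}IHr].
rewrite all_cat {}IHr andbT all_map; apply: sub_all IH => x /asboolP hx; apply/asboolP => i; rewrite /upd.
by case: eqP => // _; exact: grid_pt_in01.
Qed.

Definition near_grid N n (x x' : nat -> R) := forall i, (i < n)%N ->
  exists2 k, (k < N)%N & x' i = k%:R / N%:R /\ cell N k (x i).

(** Integral and average both have total mass 1 in each coordinate, so the error [e] does not grow
    with [n]. *)
Lemma iter_int_grid N n f f' (e : R) : (0 < N)%N ->
  (forall x x', near_grid N n x x' -> `|f x - f' x'| <= e) ->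
  `|iter_int n f - grid_avg N n f'| <= e.
Proof.
move=> N0; elim: n f f' => [|n IH] f f' hf.
  by rewrite /grid_avg /= big_seq1 expr0 invr1 mul1r; apply: hf.
rewrite grid_avgS /=.
apply: (@Rintegral_cells _ _ _ (fun k => grid_avg N n (fun x => f' (upd n (k%:R / N%:R) x)))) => //.
move=> k t kN tk; apply: IH => x x' xx'; apply: hf => i iS; rewrite /upd.
case: eqP => [_|/eqP ine]; last by apply: xx'; rewrite ltn_neqAle ine.
by exists k.
Qed.

End GridAverages.

(** * From the product kernel to the integration error on the unit ball *)

Section KernelEstimates.
Variables (R : realType) (s alpha : nat) (gamma : 'I_s -> R).
Hypothesis alpha_gt0 : (0 < alpha)%N.
Hypothesis gamma_ge0 : forall j, 0 <= gamma j.
Local Notation K := (Kalpha alpha gamma).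

Lemma KalphaC x y : K x y = K y x.
Proof. by apply: eq_bigr => j _; rewrite K1C. Qed.

Lemma Kalpha_lipschitz : exists2 C : R, 0 <= C & forall x x' y (d : R),
  cube x -> cube x' -> cube y -> (forall j, `|x j - x' j| <= d) -> `|K x y - K x' y| <= C * d.
Proof.
have [B B0 HB] := K1_bounded R alpha; have [L L0 HL] := K1_lipschitz R alpha.
rewrite /Kalpha.
(* The bound [M] on the partial product is carried along, since the product rule multiplies the
   variation of the new factor by it. *)
suff [C [M [C0 M0 H]]] : exists C M : R, [/\ 0 <= C, 0 <= M &
  forall x x' y (d : R), cube x -> cube x' -> cube y -> (forall j, `|x j - x' j| <= d) ->
  `|\prod_(j <- index_enum 'I_s) (1 + gamma j * K1 alpha (x j) (y j))| <= M /\
  `|\prod_(j <- index_enum 'I_s) (1 + gamma j * K1 alpha (x j) (y j)) -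
    \prod_(j <- index_enum 'I_s) (1 + gamma j * K1 alpha (x' j) (y j))| <= C * d].
  by exists C => // x x' y d hx hx' hy hd; apply: (H x x' y d _ _ _ _).2.
elim: (index_enum _) => [|k r [C [M [C0 M0 IH]]]].
  exists 0, 1; split => // x x' y d *; rewrite !big_nil subrr normr1 normr0 mul0r.
  by split.
have gk := gamma_ge0 k.
exists ((1 + gamma k * B) * C + gamma k * L * M), ((1 + gamma k * B) * M); split.
- by rewrite addr_ge0 ?mulr_ge0 // addr_ge0 // mulr_ge0.
- by rewrite mulr_ge0 // addr_ge0 // mulr_ge0.
move=> x x' y d hx hx' hy hd; have [IH1 IH2] := IH x x' y d hx hx' hy hd.
have hd' j : `|x' j - x j| <= d by rewrite distrC.
rewrite !big_cons; set P := \prod_(j <- r) _ in IH1 IH2 *; set P' := \prod_(j <- r) _ in IH2 *.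
have b1 z : cube z -> `|1 + gamma k * K1 alpha (z k) (y k)| <= 1 + gamma k * B.
  move=> hz; apply: le_trans (ler_normD _ _) _; rewrite normr1 lerD2l normrM ger0_norm //.
  by rewrite ler_wpM2l //; apply: HB; [exact: hz|exact: hy].
split; first by rewrite normrM ler_pM // b1.
set a := 1 + _; set a' := 1 + gamma k * K1 alpha (x' k) _.
have -> : a * P - a' * P' = a' * (P - P') + (a - a') * P by ring.
apply: le_trans (ler_normD _ _) _; rewrite [X in _ <= X]mulrDl !normrM; apply: lerD.
  by rewrite -mulrA ler_pM // b1.
have -> : gamma k * L * M * d = gamma k * (L * d) * M by ring.
rewrite ler_pM // /a /a' opprD addrACA subrr add0r -mulrBr normrM ger0_norm // ler_wpM2l //.
apply: le_trans (HL _ _ _ _ (hx k) (hy k) (hx' k) (hy k)) _.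
by rewrite subrr normr0 addr0 ler_wpM2l.
Qed.

Lemma prod1D_near (r : seq 'I_s) (g : 'I_s -> R) : (forall j, 0 <= g j) ->
  exists2 C : R, 0 <= C & forall (a : 'I_s -> R) (h : R), 0 <= h <= 1 ->
    (forall j, `|a j| <= g j * h) -> `|\prod_(j <- r) (1 + a j) - 1| <= C * h.
Proof.
move=> g0; elim: r => [|k r [C C0 IH]].
  by exists 0 => // a h *; rewrite big_nil subrr normr0 mul0r.
exists (g k * (1 + C) + C) => [|a h h01 ha]; first by rewrite addr_ge0 // mulr_ge0 // addr_ge0.
have /andP[h0 h1] := h01.
rewrite big_cons; have := IH a h h01 ha; set P := \prod_(j <- r) _ => hP.
have -> : (1 + a k) * P - 1 = a k * P + (P - 1) by ring.
apply: le_trans (ler_normD _ _) _; rewrite mulrDl normrM lerD // mulrAC ler_pM //.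
rewrite (_ : P = 1 + (P - 1)); last by ring.
apply: le_trans (ler_normD _ _) _; rewrite normr1 lerD2l (le_trans hP) //.
by rewrite -[X in _ <= X]mulr1 ler_wpM2l.
Qed.

Lemma grid_avg_Kalpha (e : R) : 0 < e -> exists N0, forall N z, (N0 < N)%N -> cube z ->
  `|grid_avg N s (fun x : nat -> R => K (fun j => x j) z) - 1| <= e.
Proof.
move=> e0; have [C C0 HC] := riemann_avg_K1 R alpha_gt0.
have [D D0 HD] := prod1D_near (index_enum 'I_s) (fun j => mulr_ge0 (gamma_ge0 j) C0).
have [N0 HN0] := le_div_natr D0 e0.
exists N0 => N z N0N hz; have Nn : (0 < N)%N by exact: leq_ltn_trans N0N.
apply: le_trans (HN0 _ N0N).
(* The factors are extended to all natural indices with default 1, the form required by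
   [grid_avg_prod]. *)
pose G (j : nat) (t : R) : R := if insub j is Some i then 1 + gamma i * K1 alpha t (z i) else 1.
have GE (j : 'I_s) t : G j t = 1 + gamma j * K1 alpha t (z j) by rewrite /G valK.
rewrite (_ : grid_avg N s _ = \prod_(j < s) riemann_avg N (G j)); last first.
  by rewrite -grid_avg_prod; apply: eq_grid_avg => x; apply: eq_bigr => j _; rewrite GE.
rewrite (_ : \prod_(j < s) _ = \prod_(j < s) (1 + gamma j * riemann_avg N (fun t => K1 alpha t (z j)))).
  apply: HD => [|j].
    by rewrite invr_ge0 ler0n /= invf_le1 ?ltr0n // ler1n.
  by rewrite normrM ger0_norm // -mulrA ler_wpM2l //; apply: HC.
apply: eq_bigr => j _; rewrite -riemann_avgZ.
have Np : N%:R != 0 :> R by rewrite pnatr_eq0 -lt0n.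
have {1}-> : 1 = riemann_avg N (fun=> 1) :> R.
  by rewrite /riemann_avg sumr_const card_ord mulVf.
by rewrite -riemann_avgD; apply: eq_riemann_avg => t _; rewrite GE.
Qed.

Definition in_cube (g : seq (R * ('I_s -> R))) :=
  forall i, (i < size g)%N -> cube (nth (0, fun=> 0) g i).2.

Lemma in_cube_cat g h : in_cube g -> in_cube h -> in_cube (g ++ h).
Proof.
move=> hg hh i; rewrite size_cat nth_cat; case: (ltnP i (size g)) => [ig _|gi ih]; first exact: hg.
by apply: hh; rewrite -(ltn_add2l (size g)) subnKC.
Qed.

Lemma in_cube_map (T : Type) (F : T -> R * ('I_s -> R)) (r : seq T) :
  (forall t, cube (F t).2) -> in_cube (map F r).
Proof.
move=> hF i; rewrite size_map; case: r => // t r ir.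
by rewrite (nth_map t).
Qed.

Lemma kcomb_norm2_ge0 g : in_cube g -> 0 <= kcomb_norm2 K g.
Proof.
move=> hg; have := @psd_Kalpha _ (size g) s alpha gamma (fun i => (nth (0, fun=> 0) g i).2).
move=> /(_ alpha_gt0 gamma_ge0 (fun i => hg _ (ltn_ord i)) (fun i => (nth (0, fun=> 0) g i).1)).
congr (_ <= _); rewrite /kcomb_norm2 (big_nth (0, fun=> 0)) big_mkord; apply: eq_bigr => i _.
by rewrite (big_nth (0, fun=> 0)) big_mkord.
Qed.

Definition kcomb_dot (g h : seq (R * ('I_s -> R))) : R :=
  \sum_(p <- g) \sum_(q <- h) p.1 * q.1 * K p.2 q.2.

(** The squared norm of [h] enters through a positive upper bound [c]: the norm itself may vanish,
    and elements approximating a unit ball function only have squared norm at most [1 + e]. *)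
Lemma kcomb_cauchy_schwarz g h (c : R) : in_cube g -> in_cube h -> 0 < c ->
  kcomb_norm2 K h <= c -> kcomb_dot g h ^+ 2 <= kcomb_norm2 K g * c.
Proof.
move=> hg hh c0 hc.
pose sc t (l : seq (R * ('I_s -> R))) := [seq (t * p.1, p.2) | p <- l].
have hs t : in_cube (sc t h).
  by move=> i; rewrite size_map => ih; rewrite (nth_map (0, fun=> 0)) //; exact: hh.
have key t : 0 <= kcomb_norm2 K g + 2 * t * kcomb_dot g h + t ^+ 2 * kcomb_norm2 K h.
  have := kcomb_norm2_ge0 (in_cube_cat hg (hs t)); congr (_ <= _).
  rewrite /kcomb_norm2 big_cat /= big_map.
  under eq_bigr do rewrite big_cat big_map /=.
  under [X in _ + X]eq_bigr do rewrite big_cat big_map /=.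
  rewrite !big_split /= -!addrA; congr (_ + _).
  rewrite [2 * t](_ : _ = t + t); last by ring.
  rewrite mulrDl -addrA /kcomb_dot; congr (_ + _).
    rewrite mulr_sumr; apply: eq_bigr => p _; rewrite mulr_sumr; apply: eq_bigr => q _; ring.
  congr (_ + _).
    rewrite exchange_big mulr_sumr; apply: eq_bigr => p _; rewrite mulr_sumr.
    by apply: eq_bigr => q _ /=; rewrite KalphaC; ring.
  rewrite mulr_sumr; apply: eq_bigr => p _; rewrite mulr_sumr; apply: eq_bigr => q _; ring.
(* The minimizer of the quadratic polynomial in [t] once its leading coefficient is replaced by
   [c]. *)
have := key (- kcomb_dot g h / c); set A := kcomb_norm2 K g; set B := kcomb_dot g h => h1.
have h2 : (- B / c) ^+ 2 * kcomb_norm2 K h <= (- B / c) ^+ 2 * c by rewrite ler_wpM2l ?sqr_ge0.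
have : 0 <= (A + 2 * (- B / c) * B + (- B / c) ^+ 2 * c) * c by rewrite mulr_ge0 ?(ltW c0) //; lra.
rewrite (_ : _ * c = A * c - B ^+ 2); last by field; rewrite gt_eqF.
by rewrite subr_ge0.
Qed.

(** For an approximating combination the left side is an inner product with [g], to which
    Cauchy-Schwarz applies; the bound passes to the pointwise limit, and then [e] tends to 0. *)
Lemma unit_ball_functional f g : rkhs_unit_ball K f -> in_cube g ->
  (\sum_(p <- g) p.1 * f p.2) ^+ 2 <= kcomb_norm2 K g.
Proof.
move=> [u [hu _ uf un]] hg.
have A0 := kcomb_norm2_ge0 hg.
have cv : (fun n => \sum_(p <- g) p.1 * kcomb_eval K (u n) p.2) @ \oo --> \sum_(p <- g) p.1 * f p.2.
  elim: g hg {A0} => [|p g IH] hg.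
    by rewrite big_nil; under eq_fun do rewrite big_nil; exact: cvg_cst.
  rewrite big_cons; under eq_fun do rewrite big_cons.
  apply: cvgD; last by apply: IH => i ig; exact: (hg i.+1).
  by apply: cvgMr; apply: uf; exact: (hg 0%N).
have bd (e : R) : 0 < e -> (\sum_(p <- g) p.1 * f p.2) ^+ 2 <= kcomb_norm2 K g * (1 + e).
  move=> e0; have [n0 Hn0] := un e e0.
  pose S n := \sum_(p <- g) p.1 * kcomb_eval K (u n) p.2.
  have cv2 : (fun n => S n * S n) @ \oo --> (\sum_(p <- g) p.1 * f p.2) * (\sum_(p <- g) p.1 * f p.2).
    exact: cvgM.
  rewrite expr2; apply: (@cvgr_to_le _ _ _ _ _ _ _ cv2).
  exists n0 => // n /= nn0; rewrite -expr2 /S.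
  rewrite (_ : \sum_(p <- g) _ = kcomb_dot g (u n)).
    by apply: (kcomb_cauchy_schwarz hg (hu n) _ (Hn0 n nn0)); rewrite addr_gt0.
  apply: eq_bigr => p _; rewrite /kcomb_eval mulr_sumr; apply: eq_bigr => q _; ring.
rewrite leNgt; apply/negP; set v := _ ^+ 2 in bd * => vA.
have [A00|An0] := eqVneq (kcomb_norm2 K g) 0.
  by have := bd 1 ltr01; rewrite A00 mul0r => h; rewrite A00 in vA; lra.
have Ap : 0 < kcomb_norm2 K g by rewrite lt_neqAle eq_sym An0.
(* With this [e] the bound becomes the midpoint of the squared norm and [v], contradicting that [v]
   is larger. *)
have := bd ((v - kcomb_norm2 K g) / (2 * kcomb_norm2 K g)).
rewrite divr_gt0 ?subr_gt0 // ?mulr_gt0 // => /(_ isT).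
rewrite (_ : _ * (1 + _) = kcomb_norm2 K g + (v - kcomb_norm2 K g) / 2); last by field.
lra.
Qed.

(** The functional bound for the difference of two point evaluations: a Lipschitz kernel makes [f]
    Hölder continuous of order 1/2. *)
Lemma unit_ball_near f x x' (C d : R) : rkhs_unit_ball K f -> cube x -> cube x' ->
  (forall z z' y (d : R), cube z -> cube z' -> cube y -> (forall j, `|z j - z' j| <= d) ->
     `|K z y - K z' y| <= C * d) ->
  (forall j, `|x j - x' j| <= d) -> (f x - f x') ^+ 2 <= 2 * (C * d).
Proof.
move=> hf hx hx' hK hd; pose g : seq (R * ('I_s -> R)) := [:: (1, x); (-1, x')].
have hg : in_cube g by case=> [|[|]].
have := unit_ball_functional hf hg; rewrite /kcomb_norm2 /g !(big_cons, big_nil) /=.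
have h1 := le_trans (ler_norm _) (hK x x' x d hx hx' hx hd).
have h2 := hK x x' x' d hx hx' hx' hd; rewrite distrC in h2; have {}h2 := le_trans (ler_norm _) h2.
rewrite (_ : (_ + _) ^+ 2 = (f x - f x') ^+ 2); last by ring.
by move=> /le_trans; apply; lra.
Qed.

Lemma unit_ball_error_le n (X : 'I_n -> 'I_s -> R) f (r : R) : (0 < n)%N ->
  (forall h, cube (X h)) -> 0 <= r ->
  n%:R^-1 * \sum_h (n%:R^-1 * \sum_h' K (X h) (X h')) - 1 <= r ^+ 2 ->
  rkhs_unit_ball K f ->
  `|cube_int f - n%:R^-1 * \sum_h f (X h)| <= r.
Proof.
move=> n0 hX r0 hr hf; set Q := n%:R^-1 * \sum_h f (X h).
have approx (e : R) : 0 < e -> `|cube_int f - Q| <= e + Num.sqrt (r ^+ 2 + 3 * e).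
  move=> e0; have [C C0 HC] := Kalpha_lipschitz.
  have [N1 HN1] := grid_avg_Kalpha e0.
  have e20 : 0 < e ^+ 2 by rewrite exprn_gt0.
  have C20 : 0 <= 2 * C by rewrite mulr_ge0.
  (* The target is [e ^+ 2] because mesh size [1 / N] controls only the square of the variation of
     [f]. *)
  have [N2 HN2] := le_div_natr C20 e20.
  pose N := (N1 + N2).+1.
  have {}HN1 z : cube z -> _ := HN1 N z (leq_addr _ _ : N1 < N)%N.
  have {}HN2 := HN2 N (leq_addl _ _ : N2 < N)%N.
  have Np : 0 < N%:R :> R by rewrite ltr0n.
  pose pt (x : nat -> R) : 'I_s -> R := fun j => x j.
  have step1 : `|cube_int f - grid_avg N s (fun x => f (pt x))| <= e.
    apply: iter_int_grid => // x x' xx'; rewrite -ler_sqr ?nnegrE ?normr_ge0 ?(ltW e0) //.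
    rewrite real_normK ?num_real //; apply: le_trans HN2; rewrite -mulrA.
    apply: (unit_ball_near hf) => // j; have [k kN [x'k xk]] := xx' j (ltn_ord j).
    - exact: (cell_sub_I01 kN).
    - by rewrite /pt x'k; exact: grid_pt_in01.
    rewrite /pt x'k; have /andP[h1 h2] := xk; move: h2; rewrite -natr1 mulrDl mul1r => h2.
    by rewrite ler_norml; lra.
  (* The difference of the grid average and [Q], as a combination of point evaluations. In its
     squared norm the grid-grid term is at most [1 + e] and each of the two cross terms at least
     [1 - e], which leaves the double average over [X] minus 1, plus [3 * e]. *)
  pose g : seq (R * ('I_s -> R)) := [seq (N%:R ^- s, pt x) | x <- grid R N s] ++
    [seq (- n%:R^-1, X h) | h <- index_enum 'I_n].
  have sumg (F : ('I_s -> R) -> R) :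
    \sum_(p <- g) p.1 * F p.2 = grid_avg N s (fun x => F (pt x)) - n%:R^-1 * \sum_h F (X h).
    rewrite /g big_cat !big_map /= /grid_avg mulr_sumr; congr (_ + _).
    by rewrite mulr_sumr -sumrN; apply: eq_bigr => h _; rewrite mulNr.
  have hg : in_cube g.
    apply: in_cube_cat; last by apply: in_cube_map => h; exact: hX.
    move=> i; rewrite size_map => ig; rewrite (nth_map (fun=> 0)) // => j.
    have /(all_nthP (fun=> 0))/(_ i ig)/asboolP := grid_in01 R s (ltn0Sn (N1 + N2)).
    exact.
  have step2 : `|grid_avg N s (fun x => f (pt x)) - Q| <= Num.sqrt (r ^+ 2 + 3 * e).
    rewrite -sqrtr_sqr ler_wsqrtr // /Q -sumg; apply: le_trans (unit_ball_functional hf hg) _.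
    rewrite /kcomb_norm2 (_ : \sum_(p <- g) _ = \sum_(p <- g) p.1 *
      (grid_avg N s (fun x => K (pt x) p.2) - n%:R^-1 * \sum_h K (X h) p.2)); last first.
      apply: eq_bigr => p _; rewrite -(sumg (K^~ p.2)) mulr_sumr; apply: eq_bigr => q _.
      by rewrite KalphaC mulrA.
    rewrite (sumg (fun z => grid_avg N s (fun x => K (pt x) z) - n%:R^-1 * \sum_h K (X h) z)).
    rewrite grid_avgD sumrB mulrBr.
    have -> : grid_avg N s (fun x => - (n%:R^-1 * \sum_h K (X h) (pt x))) =
        - (n%:R^-1 * \sum_h grid_avg N s (fun x => K (pt x) (X h))).
      rewrite (_ : (fun x => _) = fun x => - n%:R^-1 * \sum_h K (pt x) (X h)).
        by rewrite grid_avgZ mulNr /grid_avg exchange_big mulr_sumr.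
      by apply/funext => x; rewrite mulNr; congr (- (_ * _)); apply: eq_bigr => h _; rewrite KalphaC.
    have a1 : `|grid_avg N s (fun z => grid_avg N s (fun x => K (pt x) (pt z))) - 1| <= e.
      by apply: grid_avg_near => // z hz; apply: HN1 => j; apply: hz.
    have a2 := avg_near n0 (fun h => HN1 _ (hX h)).
    have a3 : n%:R^-1 * \sum_h (n%:R^-1 * \sum_h' K (X h') (X h)) - 1 <= r ^+ 2.
      by apply: le_trans hr; rewrite lerD2r ler_wpM2l ?invr_ge0 ?ler0n //;
        apply: ler_sum => h _; rewrite ler_wpM2l ?invr_ge0 ?ler0n //;
        apply: ler_sum => h' _; rewrite KalphaC.
    move: a1 a2; rewrite !ler_norml -/(pt _) => /andP[_ a1] /andP[a2 _].
    set G1 := grid_avg N s _ in a1 *; set G2 := n%:R^-1 * \sum_h grid_avg _ _ _ in a2 *.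
    lra.
  rewrite (_ : _ - Q = (cube_int f - grid_avg N s (fun x => f (pt x))) +
    (grid_avg N s (fun x => f (pt x)) - Q)); last by ring.
  exact: le_trans (ler_normD _ _) (lerD step1 step2).
rewrite leNgt; apply/negP; set a := `|_| in approx * => ra.
pose d := (a - r) / 3; have d0 : 0 < d by rewrite /d; lra.
(* Then the square root is at most [r + d], and the total is at most [r + 2 * d], which is below
   [a = r + 3 * d]. *)
pose e := Num.min d (d ^+ 2 / 3).
have e0 : 0 < e by rewrite lt_min d0 divr_gt0 // exprn_gt0.
have := approx e e0; apply/negP; rewrite -ltNge.
have ed : e <= d by rewrite ge_min lexx.
have ed2 : 3 * e <= d ^+ 2.
  have : e <= d ^+ 2 / 3 by rewrite ge_min lexx orbT.
  lra.
have : Num.sqrt (r ^+ 2 + 3 * e) <= Num.sqrt ((r + d) ^+ 2).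
  by rewrite ler_wsqrtr // sqrrD; have := mulr_ge0 r0 (ltW d0); lra.
by rewrite sqrtr_sqr ger0_norm ?addr_ge0 // ?(ltW d0) // => h; rewrite /d in ed h *; lra.
Qed.

End KernelEstimates.

(** * b-adic digits *)

Section Digits.
Variable b : nat.
Hypothesis b_gt1 : (1 < b)%N.
Implicit Types (a k m M : nat).

Let b_gt0 : (0 < b)%N := ltnW b_gt1.

Lemma ndigit_lt a k : (ndigit b a k < b)%N.
Proof. exact: ltn_pmod. Qed.

Lemma ndigit_small a k : (k < b ^ a)%N -> ndigit b a k = 0%N.
Proof. by move=> h; rewrite /ndigit divn_small // mod0n. Qed.

Lemma ndigit0 k : ndigit b 0 k = (k %% b)%N.
Proof. by rewrite /ndigit expn0 divn1. Qed.

Lemma ndigitS a k : ndigit b a.+1 k = ndigit b a (k %/ b).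
Proof. by rewrite /ndigit expnS divnMA. Qed.

(** Digit sums in the definitions run over all positions below the number itself, whereas
    orthogonality needs a common level; the vanishing of [f a 0] makes the two agree. *)
Lemma sum_ndigit_widen (V : nmodType) M M' k (f : nat -> nat -> V) :
  (forall a, f a 0%N = 0) -> (k < b ^ M)%N -> (k < b ^ M')%N ->
  \sum_(a < M) f a (ndigit b a k) = \sum_(a < M') f a (ndigit b a k).
Proof.
move=> f0; wlog MM' : M M' / (M <= M')%N.
  by move=> H h h'; case: (leqP M M') => [|/ltnW] hM; [|symmetry]; apply: H.
move=> h h'; rewrite -(big_mkord xpredT (fun a => f a (ndigit b a k))).
rewrite -[RHS](big_mkord xpredT (fun a => f a (ndigit b a k))).
rewrite (@big_cat_nat _ _ _ M 0 M') //= [X in _ = _ + X]big1_seq ?addr0 // => a.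
rewrite mem_index_iota => /and3P[_ Ma _]; rewrite ndigit_small //.
by rewrite (leq_trans h) // leq_exp2l.
Qed.

Lemma ndigit_inj M p p' : (p < b ^ M)%N -> (p' < b ^ M)%N ->
  (forall a, (a < M)%N -> ndigit b a p = ndigit b a p') -> p = p'.
Proof.
elim: M p p' => [|M IH] p p'; first by rewrite expn0 !ltnS !leqn0 => /eqP-> /eqP->.
rewrite expnS => pM p'M H.
rewrite (divn_eq p b) (divn_eq p' b) -!ndigit0 H //; congr (_ * _ + _)%N.
by apply: IH => [||a aM]; rewrite ?ltn_divLR 1?mulnC // -!ndigitS H.
Qed.

Lemma sum_ord_mul (V : nmodType) p q (F : nat -> V) :
  \sum_(h < p * q) F h = \sum_(c < q) \sum_(h < p) F (c * p + h)%N.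
Proof.
elim: q => [|q IH]; first by rewrite muln0 !big_ord0.
rewrite mulnS addnC big_split_ord big_ord_recr /= IH; congr (_ + _).
by apply: eq_bigr => h _; rewrite mulnC.
Qed.

Lemma sum_prod_ndigit (A : comNzRingType) m (F : nat -> nat -> A) :
  \sum_(h < b ^ m) \prod_(r < m) F r (ndigit b r h) = \prod_(r < m) \sum_(c < b) F r c.
Proof.
elim: m F => [|m IH] F; first by rewrite expn0 big_ord1 !big_ord0.
rewrite expnS (sum_ord_mul _ _ (fun h => \prod_(r < m.+1) F r (ndigit b r h))).
rewrite big_ord_recl -(IH (fun r => F r.+1)) mulrC mulr_suml; apply: eq_bigr => c _.
rewrite mulr_sumr; apply: eq_bigr => h _; rewrite big_ord_recl /= mulrC.
rewrite ndigit0 modnMDl modn_small //; congr (_ * _); apply: eq_bigr => r _.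
by rewrite ndigitS divnMDl // divn_small // addn0.
Qed.

End Digits.

(** * Walsh functions at a finite level and characters modulo b *)

Section FiniteWalsh.
Variables (A : fieldType) (b : nat) (w : A).
Hypothesis b_gt1 : (1 < b)%N.
Hypothesis prim_w : b.-primitive_root w.
Hypothesis b_neq0 : b%:R != 0 :> A.
Implicit Types (k l p q M : nat).

Let w_neq0 : w != 0.
Proof.
apply/eqP => w0; have := prim_expr_order prim_w; rewrite w0 expr0n gtn_eqF ?(ltnW b_gt1) //.
by move=> /eqP; rewrite eq_sym oner_eq0.
Qed.

Lemma sum_expr_unity_root (z : A) : z ^+ b = 1 ->
  \sum_(c < b) z ^+ c = if z == 1 then b%:R else 0.
Proof.
move=> zb; case: eqP => [->|/eqP z1].
  by under eq_bigr do rewrite expr1n; rewrite sumr_const card_ord.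
have := subrX1 z b; rewrite zb subrr => /esym/eqP; rewrite mulf_eq0 subr_eq0 (negPf z1) /=.
by move/eqP.
Qed.

(* The p-th cell [p/b^M, (p+1)/b^M) consists of the points whose i-th digit is the
   (M-i)-th digit of p. *)
Definition cell_phase M k p : nat := (\sum_(a < M) ndigit b a k * ndigit b (M.-1 - a) p)%N.

Definition walM M k p : A := w ^+ cell_phase M k p.

(** The sum over [k] factors over its digits into geometric sums of b-th roots of unity; a digit in
    which [p] and [q] differ makes one factor vanish. *)
Lemma walM_orthogonal M p q : (p < b ^ M)%N -> (q < b ^ M)%N ->
  \sum_(k < b ^ M) walM M k p / walM M k q = if p == q then (b ^ M)%:R else 0.
Proof.
move=> pM qM; pose z a := w ^+ ndigit b (M.-1 - a) p / w ^+ ndigit b (M.-1 - a) q.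
have zb a : z a ^+ b = 1.
  by rewrite exprMn exprVn ![_ ^+ _ ^+ b]exprAC (prim_expr_order prim_w) !expr1n divr1.
transitivity (\sum_(k < b ^ M) \prod_(a < M) z a ^+ ndigit b a k).
  apply: eq_bigr => k _; rewrite /walM /cell_phase -!prodrXr -prodf_div.
  by apply: eq_bigr => a _; rewrite /z exprMn exprVn -!exprM ![(ndigit b a k * _)%N]mulnC.
rewrite (sum_prod_ndigit b_gt1 M (fun a d => z a ^+ d)).
under eq_bigr do rewrite sum_expr_unity_root //.
case: (p =P q) => pq.
  under eq_bigr => a _ do rewrite /z pq divff ?expf_neq0 // eqxx.
  by rewrite prodr_const card_ord natrX.
have [a za] : exists a : 'I_M, z a != 1.
  apply/existsP; apply: contra_notT pq; rewrite negb_exists => /forallP H.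
  apply: (ndigit_inj b_gt1 pM qM) => a aM.
  have a'M : (M.-1 - a < M)%N by lia.
  have := H (Ordinal a'M); rewrite negbK /z /=.
  rewrite (_ : (M.-1 - (M.-1 - a))%N = a); last by lia.
  rewrite -subr_eq0 -{1}(divff (expf_neq0 (ndigit b a q) w_neq0)) -mulrBl mulf_eq0 invr_eq0.
  rewrite (negPf (expf_neq0 _ w_neq0)) orbF subr_eq0 (eq_prim_root_expr prim_w).
  by rewrite !modn_small ?ndigit_lt // => /eqP.
by rewrite (bigD1 a) //= (negPf za) mul0r.
Qed.

(** Finite Fourier inversion: the inner double sum is the Walsh coefficient of a function constant
    on pairs of cells, and the outer one resynthesizes that function. *)
Lemma walM_inversion M (c : nat -> nat -> A) p q : (p < b ^ M)%N -> (q < b ^ M)%N ->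
  \sum_(k < b ^ M) \sum_(l < b ^ M)
     ((b ^ M)%:R ^- 2 * \sum_(p' < b ^ M) \sum_(q' < b ^ M)
        c p' q' * (walM M l q' / walM M k p')) * (walM M k p / walM M l q) = c p q.
Proof.
move=> pM qM; set B := (b ^ M)%N.
have B0 : B%:R != 0 :> A by rewrite natrX expf_neq0.
transitivity (B%:R ^- 2 * \sum_(p' < B) \sum_(q' < B) c p' q' *
   ((\sum_(k < B) walM M k p / walM M k p') * (\sum_(l < B) walM M l q' / walM M l q))).
  under eq_bigr => k _ do under eq_bigr => l _ do rewrite -mulrA mulr_suml.
  under eq_bigr => k _ do rewrite -mulr_sumr exchange_big /=.
  rewrite -mulr_sumr exchange_big /=; congr (_ * _); apply: eq_bigr => p' _.
  under eq_bigr => k _ do under eq_bigr => l _ do rewrite mulr_suml.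
  under eq_bigr => k _ do rewrite exchange_big /=.
  rewrite exchange_big /=; apply: eq_bigr => q' _.
  rewrite mulr_suml mulr_sumr; apply: eq_bigr => k _.
  rewrite mulr_sumr mulr_sumr; apply: eq_bigr => l _.
  ring.
under eq_bigr => p' _ do under eq_bigr => q' _ do rewrite !walM_orthogonal //.
rewrite (bigD1 (Ordinal pM)) //= [X in _ + X]big1; last first.
  move=> p' /eqP pp'; rewrite big1 // => q' _.
  by case: eqP => [e|_]; [case: pp'; apply: val_inj|rewrite mul0r mulr0].
rewrite addr0 (bigD1 (Ordinal qM)) //= [X in _ + X]big1; last first.
  move=> q' /eqP qq'; case: (_ =P q) => [e|_]; [by case: qq'; apply: val_inj|by rewrite !mulr0].
by rewrite !eqxx addr0 -/B; field.
Qed.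

Definition zchar (v : 'Z_b) : A := w ^+ v.

Lemma zcharD : {morph zchar : u v / u + v >-> u * v}.
Proof.
move=> u v; rewrite /zchar -exprD -(prim_expr_mod prim_w (u + v)%N) /=.
by rewrite {3}(Zp_cast b_gt1).
Qed.

Lemma zchar0 : zchar 0 = 1. Proof. by rewrite /zchar. Qed.

Lemma zchar_natM n (v : 'Z_b) : zchar (n%:R * v) = w ^+ (n * v).
Proof.
elim: n => [|n IH]; first by rewrite mul0r mul0n.
by rewrite mulrS mulrDl mul1r zcharD IH mulSn exprD.
Qed.

Lemma zchar_sum I (r : seq I) (P : pred I) (F : I -> 'Z_b) :
  zchar (\sum_(i <- r | P i) F i) = \prod_(i <- r | P i) zchar (F i).
Proof. exact: (big_morph zchar zcharD zchar0). Qed.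

Lemma zchar_eq1 v : (zchar v == 1) = (v == 0).
Proof.
rewrite /zchar -(expr0 w) (eq_prim_root_expr prim_w) mod0n modn_small //.
by rewrite -{2}(Zp_cast b_gt1) ltn_ord.
Qed.

Lemma sum_zchar_ndigit m (V : 'I_m -> 'Z_b) :
  \sum_(h < b ^ m) zchar (\sum_(r < m) V r * (ndigit b r h)%:R) =
  if [forall r, V r == 0] then (b ^ m)%:R else 0.
Proof.
pose z (r : nat) : A := if insub r is Some i then zchar (V i) else 1.
have zE (r : 'I_m) : z r = zchar (V r) by rewrite /z valK.
transitivity (\sum_(h < b ^ m) \prod_(r < m) z r ^+ ndigit b r h).
  apply: eq_bigr => h _; rewrite zchar_sum; apply: eq_bigr => r _.
  by rewrite mulrC zchar_natM mulnC zE exprM.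
rewrite (sum_prod_ndigit b_gt1 m (fun r d => z r ^+ d)).
have zb (r : 'I_m) : z r ^+ b = 1.
  by rewrite zE /zchar exprAC (prim_expr_order prim_w) expr1n.
under eq_bigr do rewrite sum_expr_unity_root // zE zchar_eq1.
case: forallP => [H|H].
  by under eq_bigr do rewrite H; rewrite prodr_const card_ord natrX.
have /existsP[r Vr] : [exists r, V r != 0].
  by apply: contra_notT H; rewrite negb_exists => /forallP H r; have := H r; rewrite negbK.
by rewrite (bigD1 r) //= (negPf Vr) mul0r.
Qed.

End FiniteWalsh.

(** * The complex root of unity and Walsh functions on cells *)

Section RootOfUnity.
Local Open Scope complex_scope.
Variables (R : realType) (b : nat).
Hypothesis b_gt1 : (1 < b)%N.

Definition cis (t : R) : R[i] := cos t +i* sin t.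

Lemma cisD s t : cis (s + t) = cis s * cis t.
Proof. by rewrite /cis cosD sinD; simpc; rewrite [sin s * cos t + _]addrC. Qed.

Lemma cis0 : cis 0 = 1.
Proof. by rewrite /cis cos0 sin0. Qed.

Lemma norm_cis t : `|cis t| = 1.
Proof. by rewrite normc_def /= cos2Dsin2 sqrtr1. Qed.

Lemma cis_neq0 t : cis t != 0.
Proof. by rewrite -normr_gt0 norm_cis ltr01. Qed.

Lemma cisB s t : cis (s - t) = cis s / cis t.
Proof.
by apply/(mulIf (cis_neq0 t)); rewrite divfK ?cis_neq0 // -cisD subrK.
Qed.

Lemma cisMn t n : cis (t * n%:R) = cis t ^+ n.
Proof.
by elim: n => [|n IH]; rewrite ?mulr0 ?cis0 // -natr1 mulrDr mulr1 cisD IH exprSr.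
Qed.

Definition omega : R[i] := cis (2 * pi / b%:R).

Let b0 : 0 < b%:R :> R. Proof. by rewrite ltr0n ltnW. Qed.

Lemma omegaX n : omega ^+ n = cis (2 * pi * n%:R / b%:R).
Proof. by rewrite -cisMn mulrAC. Qed.

Lemma prim_omega : b.-primitive_root omega.
Proof.
rewrite /primitive_root_of_unity (ltnW b_gt1) /=; apply/forallP => -[i ib] /=.
rewrite unity_rootE omegaX; apply/eqP; rewrite -/(_ == _) eq_sym.
have [->|ne] := eqVneq i.+1 b.
  have -> : 2 * pi * b%:R / b%:R = pi *+ 2 :> R by rewrite mulfK ?gt_eqF // mulr_natl.
  by apply/eqP; rewrite /cis cos2pi sin2pi.
apply/negbTE; rewrite eq_sym; have {ne}ib : (i.+1 < b)%N by rewrite ltn_neqAle ne.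
(* If the power were 1, its real part [cos (2 t) = 1] would force [sin t = 0], although [t] lies
   strictly between 0 and pi. *)
apply/eqP => /(congr1 (@complex.Re R)) /=.
pose t : R := pi * i.+1%:R / b%:R.
have -> : 2 * pi * i.+1%:R / b%:R = t *+ 2 by rewrite /t -mulr_natl; ring.
rewrite cosD -!expr2 => h.
have t0 : 0 < sin t.
  apply: sin_gt0_pi; rewrite /t divr_gt0 ?mulr_gt0 ?pi_gt0 ?ltr0n ?(ltnW b_gt1) //=.
  by rewrite ltr_pdivrMr // ltr_pM2l ?pi_gt0 // ltr_nat.
have := cos2Dsin2 t; have := exprn_gt0 2 t0; lra.
Qed.

Lemma norm_omegaX n : `|omega ^+ n| = 1.
Proof. by rewrite omegaX norm_cis. Qed.

Lemma natc_neq0 n : (0 < n)%N -> n%:R != 0 :> R[i].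
Proof. by rewrite pnatr_eq0 -lt0n. Qed.

Lemma cell_coarse B n i (x : R) : (0 < n)%N -> cell (n * B) i x -> cell B (i %/ n) x.
Proof.
case: B => [|B] n0; first by rewrite muln0 /cell /= !invr0 !mulr0.
have n0R : 0 < n%:R :> R by rewrite ltr0n.
have B0 : 0 < B.+1%:R :> R by rewrite ltr0n.
rewrite /cell /= natrM !invfM => /andP[h1 h2]; apply/andP; split.
  apply: le_trans h1; rewrite mulrA ler_wpM2r ?invr_ge0 ?ler0n // ler_pdivlMr //.
  by rewrite -natrM ler_nat leq_trunc_div.
apply: lt_le_trans h2 _; rewrite mulrA ler_wpM2r ?invr_ge0 ?ler0n // ler_pdivrMr //.
by rewrite -natrM ler_nat ltn_ceil.
Qed.

Lemma xdigit_cell M a p (x : R) : (a < M)%N -> cell (b ^ M) p x ->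
  xdigit b a.+1 x = ndigit b (M.-1 - a) p.
Proof.
move=> aM /andP[h1 h2]; rewrite /xdigit /ndigit.
set c := (b ^ (M.-1 - a))%N.
have bM : (b ^ M = c * b ^ a.+1)%N by rewrite -expnD; congr (_ ^ _)%N; lia.
have c0 : (0 < c)%N by rewrite expn_gt0 ltnW.
have e0 : (0 < b ^ a.+1)%N by rewrite expn_gt0 ltnW.
have -> : Num.floor (x * b%:R ^+ a.+1) = (p %/ c)%N%:Z.
  apply: Num.Theory.floor_def; move: h1 h2; rewrite bM natrM !invfM -natrX.
  have cR : 0 < c%:R :> R by rewrite ltr0n.
  have eR : 0 < (b ^ a.+1)%:R :> R by rewrite ltr0n.
  rewrite !mulrA ler_pdivrMr // ltr_pdivlMr // => h1 h2; apply/andP; split.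
    apply: le_trans h1; rewrite ler_pdivlMr // -!pmulrn -natrM ler_nat; exact: leq_trunc_div.
  apply: lt_le_trans h2 _; rewrite ler_pdivrMr // addrC -intS -!pmulrn -natrM ler_nat; exact: ltn_ceil.
by rewrite modz_nat absz_nat.
Qed.

Lemma walsh_phase_cell M k p (x : R) : (k < b ^ M)%N -> cell (b ^ M) p x ->
  walsh_phase b k x = cell_phase b M k p.
Proof.
move=> kM xp; rewrite /walsh_phase /cell_phase.
rewrite (@sum_ndigit_widen b b_gt1 nat k M k (fun a d => d * xdigit b a.+1 x)%N) //.
  by apply: eq_bigr => a _; rewrite (xdigit_cell (ltn_ord a) xp).
exact: ltn_expl.
Qed.

End RootOfUnity.

(** * Real and imaginary parts of sums *)

Section ComplexSums.
Local Open Scope complex_scope.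
Variable R : realType.

Lemma sum_complex (I : Type) (r : seq I) (P : pred I) (F G : I -> R) :
  \sum_(i <- r | P i) (F i +i* G i) = (\sum_(i <- r | P i) F i) +i* (\sum_(i <- r | P i) G i).
Proof.
elim: r => [|i r IH]; first by rewrite !big_nil.
by rewrite !big_cons; case: (P i); rewrite IH //; simpc.
Qed.

Lemma scale_cis (x t : R) : x%:C * cis t = (x * cos t) +i* (x * sin t).
Proof. by rewrite /cis; simpc. Qed.

Lemma scale_complex (x c d : R) : x%:C * (c +i* d) = (x * c) +i* (x * d).
Proof. by simpc. Qed.

Lemma norm_complex_le (c d e : R) : `|c| <= e -> `|d| <= e -> `|c +i* d| <= (2 * e)%:C.
Proof.
move=> hc hd; have -> : c +i* d = c%:C + 'i * d%:C by simpc.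
apply: le_trans (ler_normD _ _) _.
have ni : `|'i%C : R[i]| = 1 by rewrite normc_def /= expr0n expr1n add0r sqrtr1.
rewrite normrM ni mul1r !normc_def /= !expr0n !addr0 !sqrtr_sqr -rmorphD lecR; lra.
Qed.

Lemma norm_realc (x : R) : `|x%:C| = `|x|%:C.
Proof. by rewrite normc_def /= expr0n addr0 sqrtr_sqr. Qed.

End ComplexSums.

(** * Walsh coefficients of the one-dimensional kernel *)

Section WalshCoefficients.
Local Open Scope complex_scope.
Variables (R : realType) (b alpha : nat) (L : R).
Hypothesis b_gt1 : (1 < b)%N.
Hypothesis L_ge0 : 0 <= L.
Hypothesis K1_lip : forall x y x' y' : R, 0 <= x <= 1 -> 0 <= y <= 1 -> 0 <= x' <= 1 ->
  0 <= y' <= 1 -> `|K1 alpha x y - K1 alpha x' y'| <= L * (`|x - x'| + `|y - y'|).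
Local Notation w := (omega R b).

Definition Khat (k l : nat) : R[i] :=
  walsh_coef_re (R:=R) b alpha k l +i* walsh_coef_im (R:=R) b alpha k l.

Lemma norm_Khat k l : `|Khat k l| = (walsh_coef_abs (R:=R) b alpha k l)%:C.
Proof. by rewrite normc_def. Qed.

Lemma double_integral_cells N (h : R -> R -> R) (c : nat -> nat -> R) (e : R) : (0 < N)%N ->
  (forall i j x y, (i < N)%N -> (j < N)%N -> cell N i x -> cell N j y -> `|h x y - c i j| <= e) ->
  `|\int[@lebesgue_measure R]_(y in I01) \int[@lebesgue_measure R]_(x in I01) h x y
    - N%:R^-1 * \sum_(j < N) (N%:R^-1 * \sum_(i < N) c i j)| <= e.
Proof.
move=> N0 hc.
apply: (@Rintegral_cells _ _ _ (fun j => N%:R^-1 * \sum_(i < N) c i j)) => // j y jN yj.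
by apply: (@Rintegral_cells _ _ _ (fun i => c i j)) => // i x iN xi; apply: hc.
Qed.

(** The grid refines the cells of level [M] by a factor [n], and [j %/ n] is the cell of node [j].
    Walsh functions of index below [b ^ M] are constant on these cells, so only [K1] is approximated
    and [n] may grow while [M] stays fixed. *)
Definition disc_arg M n k l i j : R :=
  2 * pi * ((cell_phase b M l (j %/ n))%:R - (cell_phase b M k (i %/ n))%:R) / b%:R.

Lemma walsh_integral_approx (T : R -> R) M n k l (N := (n * b ^ M)%N) :
  (forall t, `|T t| <= 1) -> (0 < n)%N -> (k < b ^ M)%N -> (l < b ^ M)%N ->
  `|\int[@lebesgue_measure R]_(y in I01) \int[@lebesgue_measure R]_(x in I01)
      (K1 alpha x y * T (walsh_arg b k l x y))
    - N%:R^-1 * \sum_(j < N) (N%:R^-1 * \sum_(i < N)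
        (K1 alpha (i%:R / N%:R) (j%:R / N%:R) * T (disc_arg M n k l i j)))| <= 2 * L / N%:R.
Proof.
move=> T1 n0 kM lM.
have N0 : (0 < N)%N by rewrite muln_gt0 n0 expn_gt0 ltnW.
apply: (double_integral_cells (c := fun i j =>
  K1 alpha (i%:R / N%:R) (j%:R / N%:R) * T (disc_arg M n k l i j))) => // i j x y iN jN xi yj.
have -> : walsh_arg b k l x y = disc_arg M n k l i j.
  rewrite /walsh_arg /disc_arg.
  rewrite (walsh_phase_cell b_gt1 kM (cell_coarse n0 xi)).
  by rewrite (walsh_phase_cell b_gt1 lM (cell_coarse n0 yj)).
rewrite -mulrBl normrM -[X in _ <= X]mulr1; apply: ler_pM => //.
apply: le_trans (K1_lip (cell_sub_I01 iN xi) (cell_sub_I01 jN yj) (grid_pt_in01 R iN) (grid_pt_in01 R jN)) _.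
rewrite [2 * L]mulrC -mulrA ler_wpM2l //.
have near1 (i' : nat) (z : R) : cell N i' z -> `|z - i'%:R / N%:R| <= N%:R^-1.
  by move=> /andP[h1]; rewrite -natr1 mulrDl mul1r => h2; rewrite ler_norml; lra.
by rewrite (_ : 2 / N%:R = N%:R^-1 + N%:R^-1) ?lerD // ?near1 //; ring.
Qed.

Definition cell_avg B n p q : R := n%:R^-1 * \sum_(i < n) (n%:R^-1 * \sum_(j < n)
  K1 alpha ((p * n + i)%:R / (n * B)%:R) ((q * n + j)%:R / (n * B)%:R)).

Definition disc_coef M n k l : R[i] :=
  (b ^ M)%:R ^- 2 * \sum_(p < b ^ M) \sum_(q < b ^ M)
    (cell_avg (b ^ M) n p q)%:C * (walM b w M l q / walM b w M k p).

Lemma cis_disc_arg M n k l i j :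
  cis (disc_arg M n k l i j) = walM b w M l (j %/ n) / walM b w M k (i %/ n).
Proof. by rewrite /walM !omegaX -cisB /disc_arg mulrBr mulrBl. Qed.

Lemma disc_coefE M n k l (N := (n * b ^ M)%N) : (0 < n)%N ->
  disc_coef M n k l =
  (N%:R^-1 * \sum_(j < N) (N%:R^-1 * \sum_(i < N)
        (K1 alpha (i%:R / N%:R) (j%:R / N%:R) * cos (disc_arg M n k l i j)))) +i*
  (N%:R^-1 * \sum_(j < N) (N%:R^-1 * \sum_(i < N)
        (K1 alpha (i%:R / N%:R) (j%:R / N%:R) * sin (disc_arg M n k l i j)))).
Proof.
move=> n0; rewrite -scale_complex -sum_complex.
under eq_bigr do rewrite -scale_complex -sum_complex.
under eq_bigr do under eq_bigr do rewrite -scale_cis cis_disc_arg.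
rewrite -mulr_sumr /N.
rewrite (sum_ord_mul n (b ^ M) (fun j => \sum_(i < n * b ^ M)
  (K1 alpha (i%:R / (n * b ^ M)%:R) (j%:R / (n * b ^ M)%:R))%:C *
  (walM b w M l (j %/ n) / walM b w M k (i %/ n)))).
rewrite /disc_coef exchange_big /= mulr_sumr mulrA mulr_sumr; apply: eq_bigr => q _.
under [in RHS]eq_bigr => j _ do rewrite (sum_ord_mul n (b ^ M) (fun i =>
  (K1 alpha (i%:R / (n * b ^ M)%:R) ((q * n + j)%:R / (n * b ^ M)%:R))%:C *
  (walM b w M l ((q * n + j) %/ n) / walM b w M k (i %/ n)))).
rewrite exchange_big /= !mulr_sumr; apply: eq_bigr => p _.
rewrite /cell_avg rmorphM rmorph_sum /=.
under [in LHS]eq_bigr => i _ do rewrite rmorphM rmorph_sum /=.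
rewrite exchange_big /= -!mulr_sumr.
under [in RHS]eq_bigr => i _ do under eq_bigr => j _ do
  rewrite !divnMDl // !divn_small // !addn0.
under [in RHS]eq_bigr => i _ do rewrite -mulr_suml.
rewrite -mulr_suml !mulrA; congr (_ * _ * _); rewrite !fmorphV !rmorph_nat; congr (_ * _).
by rewrite natrM !invfM; ring.
Qed.

Lemma Khat_approx M n k l : (0 < n)%N -> (k < b ^ M)%N -> (l < b ^ M)%N ->
  `|Khat k l - disc_coef M n k l| <= (4 * L / (n * b ^ M)%:R)%:C.
Proof.
move=> n0 kM lM; rewrite disc_coefE // /Khat.
set u := _ * \sum_(j < _) _; set v := _ * \sum_(j < _) _.
have -> : forall a c : R, (a +i* c) - (u +i* v) = (a - u) +i* (c - v) by move=> *; simpc.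
rewrite (_ : 4 * L / _ = 2 * (2 * L / (n * b ^ M)%:R)); last by ring.
apply: norm_complex_le; apply: walsh_integral_approx => // t.
  by rewrite ler_norml cos_geN1 cos_le1.
by rewrite ler_norml sin_geN1 sin_le1.
Qed.

Lemma norm_walM M k p : `|walM b w M k p| = 1.
Proof. exact: norm_omegaX. Qed.

(** The truncated series is compared with a cell average, and the latter with [K1 x y]. The cells
    are closed on the right because a sequence with all later digits [b - 1] has its value at the
    right endpoint. *)
Lemma Khat_inversion M p q x y (B := (b ^ M)%N) : (p < B)%N -> (q < B)%N ->
  p%:R / B%:R <= x <= p.+1%:R / B%:R -> q%:R / B%:R <= y <= q.+1%:R / B%:R ->
  `|\sum_(k < B) \sum_(l < B) Khat k l * (walM b w M k p / walM b w M l q) - (K1 alpha x y)%:C|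
     <= (6 * L / B%:R)%:C.
Proof.
move=> pB qB hx hy.
have B0 : (0 < B)%N by rewrite expn_gt0 ltnW.
have BR : 0 < B%:R :> R by rewrite ltr0n.
(* Each of the [B ^ 2] coefficients is off by at most [4 * L / (n * B)]; this [n] makes the errors
   add up to [4 * L / B]. *)
pose n := (B ^ 2)%N.
have n0 : (0 < n)%N by rewrite expn_gt0 B0.
have nR : 0 < n%:R :> R by rewrite ltr0n.
have inv := walM_inversion b_gt1 (prim_omega R b_gt1) (natc_neq0 R (ltnW b_gt1))
  (fun p q => (cell_avg B n p q)%:C) pB qB.
have h1 : `|\sum_(k < B) \sum_(l < B) Khat k l * (walM b w M k p / walM b w M l q)
   - (cell_avg B n p q)%:C| <= (4 * L / B%:R)%:C.
  rewrite -inv -sumrB; apply: le_trans (ler_norm_sum _ _ _) _.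
  have -> : (4 * L / B%:R)%:C = \sum_(k < B) \sum_(l < B) (4 * L / (n * B)%:R)%:C.
    rewrite !sumr_const !card_ord -mulrnA -!(raddfMn (real_complex R)) /=; congr (_%:C).
    rewrite -mulr_natr /n !natrM; field; lra.
  apply: ler_sum => k _; rewrite -sumrB; apply: le_trans (ler_norm_sum _ _ _) _.
  apply: ler_sum => l _; rewrite -mulrBl normrM [X in _ * X]normf_div !norm_walM divr1 mulr1.
  exact: Khat_approx.
have h2 : `|cell_avg B n p q - K1 alpha x y| <= 2 * L / B%:R.
  apply: avg_near => // i; apply: avg_near => // j.
  have B01 (r : nat) (z : R) : (r < B)%N -> r%:R / B%:R <= z <= r.+1%:R / B%:R -> 0 <= z <= 1.
    move=> rB /andP[z1 z2]; rewrite (le_trans _ z1) ?divr_ge0 ?ler0n //= (le_trans z2) //.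
    by rewrite ler_pdivrMr // mul1r ler_nat.
  have sub (r : nat) (i' : 'I_n) : r%:R / B%:R <= ((r * n + i')%:R / (n * B)%:R : R) <= r.+1%:R / B%:R.
    rewrite [(n * B)%:R]natrM natrD [(r * n)%:R]natrM invfM mulrA; apply/andP; split; rewrite ler_wpM2r ?invr_ge0 ?ler0n //.
      by rewrite ler_pdivlMr // lerDl.
    by rewrite ler_pdivrMr // -natr1 mulrDl mul1r lerD2l ler_nat ltnW.
  apply: le_trans (K1_lip _ _ _ _) _; [exact: B01 (sub p i)|exact: B01 (sub q j)|exact: B01 hx|exact: B01 hy|].
  rewrite [2 * L]mulrC -mulrA ler_wpM2l //.
  rewrite (_ : 2 / B%:R = B%:R^-1 + B%:R^-1); last by ring.
  have near1 (r : nat) (z z' : R) : r%:R / B%:R <= z <= r.+1%:R / B%:R ->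
     r%:R / B%:R <= z' <= r.+1%:R / B%:R -> `|z - z'| <= B%:R^-1.
    by rewrite -natr1 mulrDl mul1r => /andP[? ?] /andP[? ?]; rewrite ler_norml; lra.
  by apply: lerD; [exact: near1 (sub p i) hx|exact: near1 (sub q j) hy].
rewrite (_ : _ - (K1 alpha x y)%:C = (\sum_(k < B) \sum_(l < B) Khat k l * (walM b w M k p / walM b w M l q)
   - (cell_avg B n p q)%:C) + (cell_avg B n p q - K1 alpha x y)%:C); last by rewrite rmorphB; ring.
apply: le_trans (ler_normD _ _) _.
rewrite (_ : 6 * L / B%:R = 4 * L / B%:R + 2 * L / B%:R); last by ring.
by rewrite [X in _ <= X]rmorphD lerD // norm_realc lecR.
Qed.

Lemma cell_phase0 M p : cell_phase b M 0 p = 0%N.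
Proof. by rewrite /cell_phase big1 // => a _; rewrite /ndigit div0n mod0n mul0n. Qed.

(** With index 0 the Walsh factor is constant in the corresponding variable, where [K1] has mean
    zero. The assumed coefficient bound covers positive indices only, so the remaining coefficients
    are settled here. *)
Lemma walsh_integral0 (T : R -> R) k l : (0 < alpha)%N -> (forall t, `|T t| <= 1) ->
  k = 0%N \/ l = 0%N ->
  \int[@lebesgue_measure R]_(y in I01) \int[@lebesgue_measure R]_(x in I01)
      (K1 alpha x y * T (walsh_arg b k l x y)) = 0.
Proof.
move=> a0 T1 kl0; have [C C0 HC] := riemann_avg_K1 R a0.
pose M := maxn k l.
have kM : (k < b ^ M)%N by apply: leq_trans (ltn_expl k b_gt1) _; rewrite leq_exp2l // leq_maxl.
have lM : (l < b ^ M)%N by apply: leq_trans (ltn_expl l b_gt1) _; rewrite leq_exp2l // leq_maxr.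
have avg_le N (T' : nat -> R) : (0 < N)%N -> (forall j, `|T' j| <= 1) ->
  `|N%:R^-1 * \sum_(j < N) (N%:R^-1 * \sum_(i < N)
     (K1 alpha (i%:R / N%:R) (j%:R / N%:R) * T' j))| <= C / N%:R.
  move=> N0 T'1; rewrite -[X in `|X|]subr0; apply: avg_near => // j; rewrite subr0 -mulr_suml mulrA.
  rewrite normrM -[X in _ <= X]mulr1; apply: ler_pM => //.
  exact: (HC N _ N0 (grid_pt_in01 R (ltn_ord j))).
set I := Rintegral _ _ _.
suff H (e : R) : 0 < e -> `|I| <= e.
  apply/eqP; rewrite -normr_eq0 eq_le normr_ge0 andbT leNgt; apply/negP => I0.
  by have := H (`|I| / 2); rewrite divr_gt0 // => /(_ isT); lra.
move=> e0; have LC0 : 0 <= 2 * L + C by rewrite addr_ge0 // mulr_ge0.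
have [n0 /(_ n0.+1 (ltnSn _)) Hn] := le_div_natr LC0 e0.
set n := n0.+1 in Hn; pose N := (n * b ^ M)%N.
have N0 : (0 < N)%N by rewrite muln_gt0 expn_gt0 (ltnW b_gt1).
have := @walsh_integral_approx T M n k l T1 isT kM lM; rewrite -/I -/N.
set S := N%:R^-1 * _ => IS.
have SC : `|S| <= C / N%:R.
  case: kl0 => [k0|l0]; subst.
    pose T' j := T (2 * pi * (cell_phase b M l (j %/ n))%:R / b%:R).
    have := avg_le N T' N0 (fun j => T1 _); congr (`|_ * _| <= _).
    apply: eq_bigr => j _; congr (_ * _); apply: eq_bigr => i _; congr (_ * T _).
    by rewrite /disc_arg cell_phase0 subr0.
  pose T' j := T (2 * pi * - (cell_phase b M k (j %/ n))%:R / b%:R).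
  have := avg_le N T' N0 (fun j => T1 _); congr (`|_ * _| <= _).
  rewrite -!mulr_sumr exchange_big /=; congr (_ * _).
  apply: eq_bigr => j _; apply: eq_bigr => i _; rewrite K1C; congr (_ * T _).
  by rewrite /disc_arg cell_phase0 sub0r.
have -> : I = (I - S) + S by rewrite subrK.
apply: le_trans (ler_normD _ _) _; apply: le_trans (lerD IS SC) _; rewrite -mulrDl.
apply: le_trans Hn; rewrite ler_wpM2l // lef_pV2 ?posrE ?ltr0n // ler_nat.
by rewrite -[X in (X <= _)%N]muln1 leq_mul // expn_gt0 (ltnW b_gt1).
Qed.

Lemma Khat0 k l : (0 < alpha)%N -> k = 0%N \/ l = 0%N -> Khat k l = 0.
Proof.
move=> a0 kl; rewrite /Khat /walsh_coef_re /walsh_coef_im !walsh_integral0 // => t.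
  by rewrite ler_norml sin_geN1 sin_le1.
by rewrite ler_norml cos_geN1 cos_le1.
Qed.

End WalshCoefficients.

(** * Digit sequences and their real values *)

Section DigitExpansion.
Variables (R : realType) (b : nat).
Hypothesis b_gt1 : (1 < b)%N.
Implicit Types (z : nat -> 'Z_b) (M : nat).

Let b_gt0 : (0 < b)%N := ltnW b_gt1.

Lemma Zb_lt (v : 'Z_b) : (v < b)%N.
Proof. by rewrite -[X in (_ < X)%N](Zp_cast b_gt1) ltn_ord. Qed.

(* The index of the b-adic cell of level M containing z. *)
Fixpoint digpre z M : nat := if M is M'.+1 then (b * digpre z M' + z M')%N else 0%N.

Lemma digpre_lt z M : (digpre z M < b ^ M)%N.
Proof.
elim: M => //= M IH; rewrite expnS.
by apply: leq_trans (leq_mul (leqnn b) IH); rewrite mulnS addnC ltn_add2r Zb_lt.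
Qed.

Lemma ndigit_digpre z M a : (a < M)%N -> ndigit b (M.-1 - a) (digpre z M) = z a.
Proof.
elim: M => //= M IH; rewrite ltnS leq_eqVlt => /predU1P[->|aM].
  by rewrite subnn ndigit0 mulnC modnMDl modn_small ?Zb_lt.
rewrite (_ : (M - a = (M.-1 - a).+1)%N); last by lia.
by rewrite ndigitS mulnC divnMDl // divn_small ?Zb_lt // addn0 IH.
Qed.

Lemma partial_sum_digpre z n :
  \sum_(i < n) ((nat_of_ord (z i))%:R / b%:R ^+ i.+1) = (digpre z n)%:R / (b ^ n)%:R :> R.
Proof.
have bR : b%:R != 0 :> R by rewrite pnatr_eq0 -lt0n.
elim: n => [|n IH]; first by rewrite big_ord0 mul0r.
rewrite big_ord_recr /= IH natrD natrM !natrX exprS.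
by field; rewrite bR expf_neq0.
Qed.

Lemma digpre_ub z M n : (M <= n)%N ->
  (digpre z n).+1%:R / (b ^ n)%:R <= (digpre z M).+1%:R / (b ^ M)%:R :> R.
Proof.
elim: n => [|n IH]; first by rewrite leqn0 => /eqP->.
rewrite leq_eqVlt => /predU1P[->//|/IH]; apply: le_trans.
have bn : 0 < (b ^ n)%:R :> R by rewrite ltr0n expn_gt0 b_gt0.
rewrite expnS natrM invfM mulrA ler_wpM2r ?invr_ge0 ?ler0n // ler_pdivrMr ?ltr0n //.
by rewrite -natrM ler_nat /= mulSn mulnC addnC -addSn leq_add2r Zb_lt.
Qed.

(** The right bound is attained when all digits from position [M] on equal [b - 1]; the value then
    lies in the next half-open cell, so the cell has to be read off the sequence and not off the
    real number. *)
Lemma pi_b_cell z M :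
  (digpre z M)%:R / (b ^ M)%:R <= @pi_b R b z <= (digpre z M).+1%:R / (b ^ M)%:R.
Proof.
pose u n : R := \sum_(i < n) ((nat_of_ord (z i))%:R / (b%:R) ^+ i.+1).
have u_mono : {homo u : n m / (n <= m)%N >-> n <= m}.
  apply: homo_leq => // [x y t|n]; first exact: le_trans.
  by rewrite /u big_ord_recr /= lerDl divr_ge0 ?exprn_ge0 ?ler0n.
have u_le n K : (K <= n)%N -> u n <= (digpre z K).+1%:R / (b ^ K)%:R.
  move=> Kn; apply: le_trans (digpre_ub z Kn); rewrite /u partial_sum_digpre.
  by rewrite ler_wpM2r ?invr_ge0 ?ler0n // ler_nat.
have u_cvg : cvgn u.
  apply: nondecreasing_is_cvgn => //; exists ((digpre z 0).+1%:R / (b ^ 0)%:R).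
  by move=> _ [n _ <-]; apply: u_le.
apply/andP; split.
  by rewrite -partial_sum_digpre; apply: nondecreasing_cvgn_le.
by apply: limr_le => //; exists M => // n /= Mn; apply: u_le.
Qed.

Lemma pi_b_in01 z : 0 <= @pi_b R b z <= 1.
Proof. by have := pi_b_cell z 0; rewrite /= expn0 invr1 mul0r mul1r. Qed.

End DigitExpansion.

(** * Lifting an index to digit sum zero modulo b *)

Section LiftIndex.
Variable b : nat.
Hypothesis b_gt1 : (1 < b)%N.
Let b_gt0 : (0 < b)%N := ltnW b_gt1.

(* The unique k' with floor(k'/b) = k and digit sum divisible by b. *)
Definition lift_index k : nat := (k * b + (b - digsum b k %% b) %% b)%N.

Lemma lift_index_div k : (lift_index k %/ b)%N = k.
Proof. by rewrite /lift_index divnMDl // divn_small ?addn0 // ltn_pmod. Qed.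

Lemma lift_index_inj : injective lift_index.
Proof. exact: (can_inj (g := fun k => k %/ b)%N lift_index_div). Qed.

Lemma lift_index0 : lift_index 0 = 0%N.
Proof. by rewrite /lift_index /digsum big_ord0 mod0n subn0 modnn. Qed.

Lemma ndigit0_lift k : ndigit b 0 (lift_index k) = ((b - digsum b k %% b) %% b)%N.
Proof. by rewrite ndigit0 /lift_index modnMDl modn_mod. Qed.

Lemma lift_index_lt M k : (k < b ^ M)%N -> (lift_index k < b ^ M.+1)%N.
Proof. by move=> kM; rewrite expnS mulnC -ltn_divLR // lift_index_div. Qed.

Lemma sum_ndigit_lift (V : nmodType) M k (f : nat -> nat -> V) :
  (forall a, f a 0%N = 0) -> (k < b ^ M)%N ->
  \sum_(a < lift_index k) f a (ndigit b a (lift_index k)) =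
  f 0%N ((b - digsum b k %% b) %% b)%N + \sum_(a < M) f a.+1 (ndigit b a k).
Proof.
move=> f0 kM; rewrite (sum_ndigit_widen b_gt1 f0 (ltn_expl _ b_gt1) (lift_index_lt kM)).
rewrite big_ord_recl ndigit0_lift; congr (_ + _); apply: eq_bigr => a _.
by rewrite ndigitS lift_index_div.
Qed.

Lemma digsumE M k : (k < b ^ M)%N -> digsum b k = (\sum_(a < M) ndigit b a k)%N.
Proof.
by move=> kM; exact: (@sum_ndigit_widen b b_gt1 nat k M k (fun _ d => d) (fun=> erefl) (ltn_expl k b_gt1) kM).
Qed.

Lemma lift_digit_dvd k : (((b - digsum b k %% b) %% b + digsum b k) %% b = 0)%N.
Proof. by rewrite modnDml -modnDmr subnK ?modnn // ltnW // ltn_pmod. Qed.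

Lemma lift_index_Eset k : (0 < k)%N -> Eset b (lift_index k).
Proof.
move=> k0; rewrite /Eset; apply/andP; split.
  by rewrite /lift_index ltn_addr // muln_gt0 k0.
have kk := ltn_expl k b_gt1.
rewrite /digsum (@sum_ndigit_lift nat k k (fun _ d => d) (fun=> erefl) kk).
by rewrite -(digsumE kk) lift_digit_dvd.
Qed.

End LiftIndex.

(** * Perturbation of products *)

Section ProductPerturbation.
Local Open Scope complex_scope.

(** The constant is chosen before [P], so that one constant serves all subsets [u]. *)
Lemma prod_perturb (R : realType) (I : Type) (r : seq I) (B : R) : 0 <= B ->
  exists2 C : R, 0 <= C & forall (P : pred I) (x y : I -> R[i]) (e : R), 0 <= e <= 1 ->
    (forall j, `|x j - y j| <= e%:C) -> (forall j, `|y j| <= B%:C) ->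
    `|\prod_(j <- r | P j) x j - \prod_(j <- r | P j) y j| <= (C * e)%:C.
Proof.
move=> B0.
suff [C [M [C0 M0 H]]] : exists C M : R, [/\ 0 <= C, 0 <= M &
  forall (P : pred I) (x y : I -> R[i]) (e : R), 0 <= e <= 1 ->
    (forall j, `|x j - y j| <= e%:C) -> (forall j, `|y j| <= B%:C) ->
    `|\prod_(j <- r | P j) y j| <= M%:C /\
    `|\prod_(j <- r | P j) x j - \prod_(j <- r | P j) y j| <= (C * e)%:C].
  by exists C => // P x y e e01 hx hy; apply: (H P x y e e01 hx hy).2.
elim: r => [|k r [C [M [C0 M0 IH]]]].
  by exists 0, 1; split => // P x y e *; rewrite !big_nil subrr normr1 normr0 mul0r; split.
have B1 : 0 <= B + 1 by rewrite addr_ge0.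
exists ((B + 1) * C + M), ((B + 1) * M); split; [by rewrite addr_ge0 // mulr_ge0|exact: mulr_ge0|].
move=> P x y e e01 hx hy; have [IH1 IH2] := IH P x y e e01 hx hy.
have /andP[e0 e1] := e01.
rewrite !big_cons; case: (P k); last first.
  split; [apply: le_trans IH1 _|apply: le_trans IH2 _]; rewrite lecR.
    by rewrite -[X in X <= _]mul1r ler_wpM2r // lerDr.
  rewrite ler_wpM2r // -[X in X <= _]addr0 lerD // -[X in X <= _]mul1r ler_wpM2r //.
  by rewrite lerDr.
split.
  rewrite normrM rmorphM ler_pM //; apply: le_trans (hy k) _.
  by rewrite lecR lerDl.
set X := \prod_(j <- r | P j) x j in IH2 *; set Y := \prod_(j <- r | P j) y j in IH1 IH2 *.
have -> : x k * X - y k * Y = x k * (X - Y) + (x k - y k) * Y by ring.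
apply: le_trans (ler_normD _ _) _; rewrite [X in _ <= X%:C]mulrDl [X in _ <= X]rmorphD !normrM; apply: lerD.
  rewrite -mulrA [X in _ <= X]rmorphM ler_pM //.
  rewrite (_ : x k = y k + (x k - y k)); last by ring.
  apply: le_trans (ler_normD _ _) _; rewrite [X in _ <= X]rmorphD lerD //.
  by apply: le_trans (hx k) _; rewrite lecR.
by rewrite mulrC rmorphM ler_pM.
Qed.

End ProductPerturbation.

(** The cross terms are nonnegative. This passes from the sum over subsets in the squared error to
    the square of the sum in the bound. *)
Lemma sum_sqr_le (R : realDomainType) (I : finType) (P : pred I) (a : I -> R) :
  (forall i, 0 <= a i) -> \sum_(i | P i) a i ^+ 2 <= (\sum_(i | P i) a i) ^+ 2.
Proof.
move=> a0; rewrite [X in _ <= X]expr2 mulr_suml; apply: ler_sum => i Pi.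
by rewrite expr2 ler_wpM2l // (bigD1 i) //= lerDl sumr_ge0.
Qed.

(** * Averages of the kernel over the folded net *)

Section FoldedNet.
Local Open Scope complex_scope.
Variables (R : realType) (b s m alpha : nat) (gamma : 'I_s -> R).
Variables (C : 'I_s -> nat -> 'I_m -> 'Z_b) (D : R).
Hypothesis b_gt1 : (1 < b)%N.
Hypothesis alpha_gt0 : (0 < alpha)%N.
Hypothesis gamma_ge0 : forall j, 0 <= gamma j.
Hypothesis D_gt0 : 0 < D.
Hypothesis walsh_bound : forall k l : nat, (0 < k)%N -> (0 < l)%N ->
     walsh_coef_abs (R:=R) b alpha k l
       <= D * (b%:R : R) ^- (mu_alpha b alpha k + mu_alpha b alpha l)%N.
Local Notation w := (omega R b).
Local Notation X := (fun h : nat => @folded_point R b s m C h).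
Local Notation z := (fun h j => fold_b (net_point C h j)).
Local Notation zch := (zchar (b := b) w).
Implicit Types (u : {set 'I_s}) (M : nat).

Let b_gt0 : (0 < b)%N := ltnW b_gt1.
Let prim_w := prim_omega R b_gt1.
Let bC_neq0 : b%:R != 0 :> R[i] := natc_neq0 R b_gt0.

Lemma folded_point_cube h : cube (X h).
Proof. by move=> j; exact: pi_b_in01. Qed.

Definition digit_dot M k (y : nat -> 'Z_b) : 'Z_b := \sum_(a < M) (ndigit b a k)%:R * y a.

(** The reversal of digits in [cell_phase] undoes the reversal in [digpre], which turns Walsh
    functions into characters of the digit sequence. *)
Lemma walM_digpre M k y : walM b w M k (digpre y M) = zch (digit_dot M k y).
Proof.
rewrite /walM /cell_phase -prodrXr /digit_dot (zchar_sum b_gt1 prim_w).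
apply: eq_bigr => a _; rewrite (zchar_natM b_gt1 prim_w).
by rewrite (ndigit_digpre b_gt1 y (ltn_ord a)).
Qed.

Definition wal_partial M (y y' : nat -> 'Z_b) : R[i] := \sum_(k < b ^ M) \sum_(l < b ^ M)
   Khat R b alpha k l * (zch (digit_dot M k y) / zch (digit_dot M l y')).

Lemma wal_partial_approx : exists2 L : R, 0 <= L & forall M y y',
  `|wal_partial M y y' - (K1 alpha (@pi_b R b y) (@pi_b R b y'))%:C| <= (L / (b ^ M)%:R)%:C.
Proof.
have [L L0 HL] := K1_lipschitz R alpha.
exists (6 * L) => [|M y y']; first by rewrite mulr_ge0.
rewrite /wal_partial; under eq_bigr do under eq_bigr do rewrite -!walM_digpre.
by apply: (Khat_inversion b_gt1 L0 HL); rewrite ?digpre_lt //; exact: pi_b_cell.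
Qed.

(* Coefficient matrix of the j-th factor of the expansion over u: the factors
   outside u are the constant 1. *)
Definition fac u (j : 'I_s) (k l : nat) : R[i] :=
  if j \in u then Khat R b alpha k l else ((k == 0%N) && (l == 0%N))%:R.

Definition wt u (j : 'I_s) (k : nat) : R :=
  if j \in u then (if k == 0%N then 0 else Num.sqrt D * b%:R ^- mu_alpha b alpha k)
  else (k == 0%N)%:R.

Lemma wt_ge0 u j k : 0 <= wt u j k.
Proof.
rewrite /wt; case: ifP => _; last exact: ler0n.
by case: ifP => _ //; rewrite mulr_ge0 ?sqrtr_ge0 // invr_ge0 exprn_ge0 // ler0n.
Qed.

Lemma norm_fac_le u j k l : `|fac u j k l| <= (wt u j k * wt u j l)%:C.
Proof.
rewrite /fac /wt; case: ifP => _.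
  have [L L0 HL] := K1_lipschitz R alpha.
  have [k0|k0] := eqVneq k 0%N; first by rewrite (Khat0 b_gt1 L0 HL) ?normr0 ?mul0r //; left.
  have [l0|l0] := eqVneq l 0%N; first by rewrite (Khat0 b_gt1 L0 HL) ?normr0 ?mulr0 //; right.
  rewrite norm_Khat lecR; apply: le_trans (walsh_bound _ _) _; rewrite ?lt0n //.
  rewrite mulrACA -expr2 sqr_sqrtr ?(ltW D_gt0) // exprD invfM.
  by [].
by rewrite normr_nat; case: eqP => _; case: eqP => _ /=; rewrite ?mulr0 ?mul0r ?mul1r // lecR.
Qed.

Lemma digit_dot0 M y : digit_dot M 0 y = 0.
Proof. by rewrite /digit_dot big1 // => a _; rewrite /ndigit div0n mod0n mul0r. Qed.

Lemma prod_wal_partial u M (y y' : 'I_s -> nat -> 'Z_b) :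
  \prod_(j in u) wal_partial M (y j) (y' j) =
  \sum_(k : {ffun 'I_s -> 'I_(b ^ M)}) \sum_(l : {ffun 'I_s -> 'I_(b ^ M)})
    (\prod_j fac u j (k j) (l j)) *
    (zch (\sum_j digit_dot M (k j) (y j)) * zch (- \sum_j digit_dot M (l j) (y' j))).
Proof.
have BM : (0 < b ^ M)%N by rewrite expn_gt0 b_gt0.
transitivity (\prod_j \sum_(k < b ^ M) \sum_(l < b ^ M) fac u j k l *
   (zch (digit_dot M k (y j)) / zch (digit_dot M l (y' j)))).
  rewrite big_mkcond; apply: eq_bigr => j _; rewrite /fac.
  case: (j \in u) => //; rewrite (bigD1 (Ordinal BM)) //= (bigD1 (Ordinal BM)) //=.
  rewrite !digit_dot0 !zchar0 divr1 mul1r big1 => [|l l0].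
    rewrite big1 ?addr0 // => k k0; rewrite big1 // => l _.
    by rewrite (_ : (k == 0%N :> nat) = false) ?mul0r //; apply/negbTE.
  by rewrite (_ : (l == 0%N :> nat) = false) ?mul0r //; apply/negbTE.
rewrite bigA_distr_bigA /=; apply: eq_bigr => k _.
rewrite bigA_distr_bigA /=; apply: eq_bigr => l _.
rewrite big_split /=; congr (_ * _).
rewrite prodf_div -!(zchar_sum b_gt1 prim_w); congr (_ * _).
apply: (@mulIf _ (zch (\sum_j digit_dot M (l j) (y' j)))); first exact/expf_neq0/cis_neq0.
by rewrite -(zcharD b_gt1 prim_w) addNr zchar0 mulVf //; exact/expf_neq0/cis_neq0.
Qed.

Definition fold_dual M (k : 'I_s -> nat) : bool :=
  [forall r : 'I_m, \sum_j \sum_(a < M) (ndigit b a (k j))%:R * (C j a.+1 r - C j 0%N r) == 0].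

Lemma dot_net M (k : 'I_s -> nat) h : \sum_j digit_dot M (k j) (z h j) =
  \sum_(r < m) (\sum_j \sum_(a < M) (ndigit b a (k j))%:R * (C j a.+1 r - C j 0%N r)) * (ndigit b r h)%:R.
Proof.
under [RHS]eq_bigr => r _ do rewrite mulr_suml.
rewrite [RHS]exchange_big /=; apply: eq_bigr => j _; rewrite /digit_dot.
under [RHS]eq_bigr => r _ do rewrite mulr_suml.
rewrite [RHS]exchange_big /=; apply: eq_bigr => a _; rewrite /fold_b /net_point -sumrB mulr_sumr.
by apply: eq_bigr => r _; rewrite -mulrBl mulrA.
Qed.

Lemma sum_net_char M (k : 'I_s -> nat) :
  (b ^ m)%:R^-1 * \sum_(h < b ^ m) zch (\sum_j digit_dot M (k j) (z h j)) = (fold_dual M k)%:R.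
Proof.
under eq_bigr do rewrite dot_net.
rewrite (sum_zchar_ndigit b_gt1 prim_w) /fold_dual.
by case: ifP => _; rewrite ?mulr0 // mulVf // natrX expf_neq0.
Qed.

Lemma sum_net_charN M (k : 'I_s -> nat) :
  (b ^ m)%:R^-1 * \sum_(h < b ^ m) zch (- \sum_j digit_dot M (k j) (z h j)) = (fold_dual M k)%:R.
Proof.
under eq_bigr do rewrite dot_net -sumrN.
under eq_bigr do under eq_bigr do rewrite -mulNr.
rewrite (sum_zchar_ndigit b_gt1 prim_w) /fold_dual.
under eq_forallb do rewrite oppr_eq0.
by case: ifP => _; rewrite ?mulr0 // mulVf // natrX expf_neq0.
Qed.

Definition net_sum u M : R :=
  \sum_(k : {ffun 'I_s -> 'I_(b ^ M)}) (fold_dual M (fun j => k j))%:R * \prod_j wt u j (k j).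

Lemma net_sum_ge0 u M : 0 <= net_sum u M.
Proof. by apply: sumr_ge0 => k _; rewrite mulr_ge0 ?ler0n // prodr_ge0 // => j _; exact: wt_ge0. Qed.

Lemma norm_wal_partial_avg u M :
  `|(b ^ m)%:R^-1 * \sum_(h < b ^ m) ((b ^ m)%:R^-1 * \sum_(h' < b ^ m)
      \prod_(j in u) wal_partial M (z h j) (z h' j))| <= (net_sum u M ^+ 2)%:C.
Proof.
have -> : (b ^ m)%:R^-1 * \sum_(h < b ^ m) ((b ^ m)%:R^-1 * \sum_(h' < b ^ m)
      \prod_(j in u) wal_partial M (z h j) (z h' j)) =
  \sum_(k : {ffun 'I_s -> 'I_(b ^ M)}) \sum_(l : {ffun 'I_s -> 'I_(b ^ M)})
    (\prod_j fac u j (k j) (l j)) *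
    ((fold_dual M (fun j => k j))%:R * (fold_dual M (fun j => l j))%:R) :> R[i].
  under eq_bigr do under eq_bigr do rewrite prod_wal_partial.
  under eq_bigr do rewrite exchange_big /= mulr_sumr.
  rewrite exchange_big /= mulr_sumr; apply: eq_bigr => k _.
  under eq_bigr do rewrite exchange_big /= mulr_sumr.
  rewrite exchange_big /= mulr_sumr; apply: eq_bigr => l _.
  under eq_bigr do rewrite -mulr_sumr -mulr_sumr.
  under eq_bigr do rewrite mulrCA [X in _ * X]mulrCA sum_net_charN.
  rewrite -mulr_sumr mulrCA; congr (_ * _).
  by rewrite -mulr_suml mulrA sum_net_char.
apply: le_trans (ler_norm_sum _ _ _) _.
rewrite expr2 /net_sum mulr_suml rmorph_sum /=; apply: ler_sum => k _.
apply: le_trans (ler_norm_sum _ _ _) _.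
rewrite mulr_sumr rmorph_sum /=; apply: ler_sum => l _.
rewrite [X in _ <= X%:C](_ : _ = (\prod_j (wt u j (k j) * wt u j (l j))) *
   ((fold_dual M (fun j => k j))%:R * (fold_dual M (fun j => l j))%:R)); last first.
  by rewrite big_split /=; ring.
rewrite normrM rmorphM; apply: ler_pM => //.
  rewrite normr_prod rmorph_prod; apply: ler_prod => j _.
  by rewrite normr_ge0 norm_fac_le.
by rewrite normrM !normr_nat rmorphM !rmorph_nat.
Qed.

Lemma prod_wt u (k : 'I_s -> nat) : \prod_j wt u j (k j) =
  if [forall j, (k j != 0%N) == (j \in u)]
  then Num.sqrt D ^+ #|u| * b%:R ^- (\sum_(j in u) mu_alpha b alpha (k j)) else 0.
Proof.
case: ifPn => [/forallP H|].
  transitivity (\prod_(j in u) (Num.sqrt D * b%:R ^- mu_alpha b alpha (k j))).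
    rewrite [RHS]big_mkcond; apply: eq_bigr => j _; rewrite /wt.
    by have /eqP <- := H j; case: eqVneq.
  by rewrite big_split /= prodr_const prodfV prodrXr.
rewrite negb_forall => /existsP[j hj]; rewrite (bigD1 j) //= {1}/wt.
by move: hj; case: (j \in u); case: (k j == 0%N) => //= _; rewrite ?mulr0n mul0r.
Qed.

Lemma fold_dual_in_dual M (k : 'I_s -> nat) : (forall j, (k j < b ^ M)%N) -> fold_dual M k ->
  in_dual C (fun j => lift_index b (k j)).
Proof.
move=> kM /forallP H r; apply: etrans (eqP (H r)); apply: eq_bigr => j _.
rewrite (sum_ndigit_lift b_gt1 (f := fun i d => C j i r * d%:R) (fun=> mulr0 _) (kM j)).
set d0 := ((b - _) %% b)%N.
have -> : d0%:R = - (\sum_(a < M) ndigit b a (k j))%N%:R :> 'Z_b.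
  apply/eqP; rewrite -addr_eq0 -(digsumE b_gt1 (kM j)) -natrD.
  by rewrite -(Zp_nat_mod b_gt1) /d0 lift_digit_dvd.
rewrite natr_sum mulrN mulr_sumr addrC -sumrB; apply: eq_bigr => a _.
by rewrite mulrBr ![_%:R * _]mulrC.
Qed.

Lemma net_sum_le_esum u M : ((net_sum u M)%:E <= (Num.sqrt D ^+ #|u|)%:E *
   \esum_(k in dual_Eu C u) ((b%:R : R) ^- (\sum_(j in u) mu_alpha b alpha (k j %/ b))%N)%:E)%E.
Proof.
pose good (k : {ffun 'I_s -> 'I_(b ^ M)}) :=
  fold_dual M (fun j => k j) && [forall j, (k j != 0%N :> nat) == (j \in u)].
pose up (k : {ffun 'I_s -> 'I_(b ^ M)}) : {ffun 'I_s -> nat} := [ffun j => lift_index b (k j)].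
have up_inj : injective up.
  move=> k k' /ffunP e; apply/ffunP => j; apply: val_inj; have := e j.
  by rewrite !ffunE => /(lift_index_inj b_gt1).
have -> : net_sum u M = Num.sqrt D ^+ #|u| *
    \sum_(k | good k) b%:R ^- (\sum_(j in u) mu_alpha b alpha (k j)).
  rewrite /net_sum mulr_sumr [RHS]big_mkcond; apply: eq_bigr => k _; rewrite prod_wt /good.
  by case: (fold_dual _ _); case: ifP => _ /=; rewrite ?mul1r ?mul0r ?mulr0.
rewrite EFinM lee_wpmul2l ?lee_fin ?exprn_ge0 ?sqrtr_ge0 //.
pose r := [seq up k | k <- enum good].
apply: esum_ge; exists [set` r].
  split; first exact: finite_seq.
  move=> k' /= /mapP[k]; rewrite mem_enum => /andP[kd /forallP ku] ->; split.
    have := fold_dual_in_dual (fun j => ltn_ord (k j)) kd.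
    by congr in_dual; apply/funext => j; rewrite ffunE.
  move=> j; rewrite ffunE; have /eqP <- := ku j; split => [k0|].
    by apply: lift_index_Eset => //; rewrite lt0n.
  by rewrite negbK => /eqP ->; exact: lift_index0.
rewrite -fsbig_seq; last by rewrite map_inj_uniq // enum_uniq.
rewrite big_map big_enum /= -sumEFin; apply: lee_sum => k _.
rewrite lee_fin; under [X in _ <= b%:R ^- X]eq_bigr do rewrite ffunE (lift_index_div b_gt1).
by [].
Qed.

Definition kernel_avg u : R := (b ^ m)%:R^-1 * \sum_(h < b ^ m) ((b ^ m)%:R^-1 *
  \sum_(h' < b ^ m) \prod_(j in u) K1 alpha (X h j) (X h' j)).

Lemma Kalpha_avgE :
  (b ^ m)%:R^-1 * \sum_(h < b ^ m) ((b ^ m)%:R^-1 *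
     \sum_(h' < b ^ m) Kalpha alpha gamma (X h) (X h')) - 1 =
  \sum_(u | u != finset.set0) (\prod_(j in u) gamma j) * kernel_avg u.
Proof.
have bm : (b ^ m)%:R != 0 :> R by rewrite pnatr_eq0 -lt0n expn_gt0 b_gt0.
have KE x y : Kalpha alpha gamma x y =
   \sum_(u : {set 'I_s}) (\prod_(j in u) gamma j) * \prod_(j in u) K1 alpha (x j) (y j).
  rewrite /Kalpha; under eq_bigr do rewrite addrC.
  rewrite bigA_distr /=; apply: eq_bigr => u _.
  by rewrite -big_split [RHS]big_mkcond.
have -> : (b ^ m)%:R^-1 * \sum_(h < b ^ m) ((b ^ m)%:R^-1 *
     \sum_(h' < b ^ m) Kalpha alpha gamma (X h) (X h')) =
   \sum_(u : {set 'I_s}) (\prod_(j in u) gamma j) * kernel_avg u.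
  under eq_bigr do under eq_bigr do rewrite KE.
  under eq_bigr do rewrite exchange_big /= mulr_sumr.
  rewrite exchange_big /= mulr_sumr; apply: eq_bigr => u _.
  under eq_bigr do rewrite -mulr_sumr mulrCA.
  by rewrite -mulr_sumr mulrCA.
rewrite (bigD1 (finset.set0 : {set 'I_s})) //= /kernel_avg big_set0 mul1r.
rewrite [X in X + _ - 1](_ : _ = 1); first by rewrite addrAC subrr add0r.
under eq_bigr do under eq_bigr do rewrite big_set0.
by under eq_bigr do rewrite sumr_const card_ord mulVf //; rewrite sumr_const card_ord mulVf.
Qed.

Lemma kernel_avg_le : exists2 E : R, 0 <= E & forall u M, E <= (b ^ M)%:R ->
  kernel_avg u <= net_sum u M ^+ 2 + E / (b ^ M)%:R.
Proof.
have [B B0 HB] := K1_bounded R alpha.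
have [P P0 HP] := prod_perturb (index_enum 'I_s) B0.
have [L L0 HL] := wal_partial_approx.
exists (P * L + L) => [|u M hM]; first by rewrite addr_ge0 // mulr_ge0.
have bM : 0 < (b ^ M)%:R :> R by rewrite ltr0n expn_gt0 b_gt0.
have bm : 0 < (b ^ m)%:R :> R by rewrite ltr0n expn_gt0 b_gt0.
have PL0 : 0 <= P * L by rewrite mulr_ge0.
pose e := L / (b ^ M)%:R.
have e01 : 0 <= e <= 1.
  apply/andP; split; first by rewrite divr_ge0 // ltW.
  by rewrite ler_pdivrMr // mul1r; apply: le_trans hM; rewrite lerDr.
have near h h' : `|\prod_(j in u) wal_partial M (z h j) (z h' j) -
   (\prod_(j in u) K1 alpha (X h j) (X h' j))%:C| <= (P * e)%:C.
  rewrite rmorph_prod; apply: HP => // j.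
  by rewrite norm_realc lecR; apply: HB; exact: folded_point_cube.
set W := (b ^ m)%:R^-1 * \sum_(h < b ^ m) ((b ^ m)%:R^-1 * \sum_(h' < b ^ m)
      \prod_(j in u) wal_partial M (z h j) (z h' j)).
have WE : `|W - (kernel_avg u)%:C| <= (P * e)%:C.
  have -> : W - (kernel_avg u)%:C = (b ^ m)%:R^-1 * \sum_(h < b ^ m) ((b ^ m)%:R^-1 *
     \sum_(h' < b ^ m) (\prod_(j in u) wal_partial M (z h j) (z h' j) -
        (\prod_(j in u) K1 alpha (X h j) (X h' j))%:C)) - 0.
    rewrite subr0 /W /kernel_avg rmorphM fmorphV rmorph_nat rmorph_sum /= -mulrBr -sumrB.
    congr (_ * _); apply: eq_bigr => h _.
    by rewrite rmorphM fmorphV rmorph_nat rmorph_sum /= -mulrBr -sumrB.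
  apply: avg_near => [|h]; first by rewrite expn_gt0 b_gt0.
  rewrite subr0 -[X in `|X|]subr0; apply: avg_near => [|h']; first by rewrite expn_gt0 b_gt0.
  by rewrite subr0.
rewrite -lecR; apply: le_trans (_ : (kernel_avg u)%:C <= `|(kernel_avg u)%:C|) _.
  by rewrite norm_realc lecR ler_norm.
rewrite (_ : (kernel_avg u)%:C = W - (W - (kernel_avg u)%:C)); last by ring.
apply: le_trans (ler_normB _ _) _; rewrite [X in _ <= X]rmorphD lerD //.
  exact: norm_wal_partial_avg.
by apply: le_trans WE _; rewrite lecR /e mulrA ler_wpM2r ?lerDl.
Qed.

Lemma Kalpha_avg_le (r : R) : bound_rhs alpha gamma D C = r%:E ->
  (b ^ m)%:R^-1 * \sum_(h < b ^ m) ((b ^ m)%:R^-1 *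
     \sum_(h' < b ^ m) Kalpha alpha gamma (X h) (X h')) - 1 <= r ^+ 2.
Proof.
move=> rhs; rewrite Kalpha_avgE; have [E E0 HE] := kernel_avg_le.
pose G : R := \sum_(u : {set 'I_s} | u != finset.set0) \prod_(j in u) gamma j.
have gu0 u : 0 <= \prod_(j in u) gamma j by apply: prodr_ge0.
have G0 : 0 <= G by apply: sumr_ge0.
set S := \sum_(u | _) _.
have key M : E <= (b ^ M)%:R -> S <= r ^+ 2 + G * E / (b ^ M)%:R.
  move=> hM; pose a u := Num.sqrt (\prod_(j in u) gamma j) * net_sum u M.
  have a0 u : 0 <= a u by rewrite mulr_ge0 ?sqrtr_ge0 // net_sum_ge0.
  have ar : \sum_(u : {set 'I_s} | u != finset.set0) a u <= r.
    rewrite -lee_fin -rhs /bound_rhs -sumEFin; apply: lee_sum => u _.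
    rewrite /a !EFinM -muleA lee_wpmul2l ?lee_fin ?sqrtr_ge0 //; exact: net_sum_le_esum.
  apply: (@le_trans _ _ (\sum_(u : {set 'I_s} | u != finset.set0) a u ^+ 2 + G * E / (b ^ M)%:R)).
    rewrite /S /G -mulrA mulr_suml -big_split /=; apply: ler_sum => u _.
    by rewrite /a exprMn sqr_sqrtr // -mulrDr ler_wpM2l // HE.
  rewrite lerD2r; apply: le_trans (sum_sqr_le _ a0) _; rewrite ler_sqr ?nnegrE ?sumr_ge0 //.
  by apply: le_trans ar; apply: sumr_ge0.
rewrite leNgt; apply/negP => rS; pose e := (S - r ^+ 2) / 2.
have e0 : 0 < e by rewrite /e; lra.
have [N1 H1] := le_div_natr (mulr_ge0 G0 E0) e0.
have [N2 H2] := le_div_natr E0 ltr01.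
pose M := maxn N1 N2.
have MM : (M < b ^ M)%N by exact: ltn_expl.
have h1 := H1 _ (leq_ltn_trans (leq_maxl N1 N2) MM).
have h2 := H2 _ (leq_ltn_trans (leq_maxr N1 N2) MM).
have bM : 0 < (b ^ M)%:R :> R by rewrite ltr0n expn_gt0 b_gt0.
have := key M; rewrite ler_pdivrMr // mul1r in h2 => /(_ h2).
by rewrite /e in h1; lra.
Qed.

End FoldedNet.

Theorem theorem4p1 (R : realType) (b s m alpha : nat) (gamma : 'I_s -> R)
  (C : 'I_s -> nat -> 'I_m -> 'Z_b) (D : R) :
  (1 < b)%N -> (0 < s)%N -> (0 < m)%N -> (2 <= alpha)%N ->
  (forall j, 0 <= gamma j) ->
  0 < D ->
  (forall k l : nat, (0 < k)%N -> (0 < l)%N ->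
     walsh_coef_abs (R:=R) b alpha k l
       <= D * (b%:R : R) ^- (mu_alpha b alpha k + mu_alpha b alpha l)%N) ->
  (@wce_folded R b s m alpha gamma C <= @bound_rhs R b s m alpha gamma D C)%E.
Proof.
move=> b1 _ _ a2 g0 D0 hW; have a0 : (0 < alpha)%N by exact: ltnW.
have rhs0 : (0 <= @bound_rhs R b s m alpha gamma D C)%E.
  apply: sume_ge0 => u _; apply: mule_ge0.
    by rewrite lee_fin mulr_ge0 ?exprn_ge0 ?sqrtr_ge0.
  by apply: esum_ge0 => k _; rewrite lee_fin invr_ge0 exprn_ge0 ?ler0n.
case E: (bound_rhs _ _ _ _) rhs0 => [r| |] // rhs0; last by rewrite leey.
apply: ub_ereal_sup => _ [f hf <-]; rewrite lee_fin.
apply: (@unit_ball_error_le R s alpha gamma a0 g0 (b ^ m) (fun h => folded_point C h)) hf => //.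
- by rewrite expn_gt0 (ltnW b1).
- by move=> h; exact: folded_point_cube.
exact: Kalpha_avg_le E.
Qed.
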